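(* The following are equivalent for a noetherian ring $R$: (1) $R$ is Cohen--Macaulay. (2) $R$ is regularly subperfect. (3) $R_M$ is $\operatorname{ht}(M)$-subperfect for each maximal ideal $M$ of $R$, where $\operatorname{ht}(M)$ denotes the height of $M$.
   Context: All rings are commutative with identity. A ring is perfect if every flat module over it is projective (equivalently, it satisfies the descending chain condition on principal ideals). $Q(A)$ denotes the total quotient ring of a ring $A$, and $A$ is subperfect if $Q(A)$ is perfect. A sequence $x_1,\ldots,x_i$ in $A$ is a regular sequence if $(x_1,\ldots,x_i)A\neq A$ and each $x_j$ is a non-zero-divisor on $A/(x_1,\ldots,x_{j-1})A$; the empty sequence is considered a regular sequence. A ring $A$ is regularly subperfect if for each regular sequence $x_1,\ldots,x_i$ in $A$ (including the empty one) the ring $A/(x_1,\ldots,x_i)A$ is subperfect. For an integer $n\ge 0$, $A$ is $n$-subperfect if $A$ is regularly subperfect and every maximal regular sequence in $A$ has length $n$. Cohen--Macaulay has its usual meaning for noetherian rings. *)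

(* Defs.v *)
From HB Require Import structures.
From mathcomp Require Import all_boot all_algebra.
From mathcomp Require Import boolp ring.

Set Implicit Arguments.
Unset Strict Implicit.
Unset Printing Implicit Defensive.

Import GRing.Theory.

Local Open Scope ring_scope.
Local Open Scope quotient_scope.

(* Rings are comPzRingType: commutative with identity, 1 = 0 being allowed.
   An improper ideal, and the quotient by it, are therefore legitimate, unlike
   with [idealr] and [{ideal_quot I}], which require properness. Subsets are
   boolean predicates; classical logic is used through [asbool]. *)

Record ideal (A : comPzRingType) := Ideal {
  ideal_pred :> {pred A};
  ideal_subproof : 0 \in ideal_pred /\
    forall a, {in ideal_pred &, forall x y, a * x + y \in ideal_pred}
}.

Section IdealTheory.
Variables (A : comPzRingType) (I : ideal A).

Lemma ideal0 : 0 \in I.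
Proof. by case: (ideal_subproof I). Qed.

Lemma idealMD a x y : x \in I -> y \in I -> a * x + y \in I.
Proof. by case: (ideal_subproof I) => _ h hx hy; apply: h. Qed.

Lemma idealM a x : x \in I -> a * x \in I.
Proof. by move=> hx; rewrite -[a * x]addr0 idealMD // ideal0. Qed.

Lemma ideal_zmod_closed : zmod_closed I.
Proof.
split=> [|x y hx hy]; first exact: ideal0.
by rewrite -mulN1r addrC idealMD.
Qed.

HB.instance Definition _ :=
  GRing.isZmodClosed.Build A (ideal_pred I) ideal_zmod_closed.

End IdealTheory.

Section Generated.
Variable A : comPzRingType.

Definition gen_pred (xs : seq A) : {pred A} :=
  [pred y | `[< exists c : 'I_(size xs) -> A,
                  y = \sum_(i < size xs) c i * xs`_i >]].

Lemma gen_subproof (xs : seq A) : 0 \in gen_pred xs /\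
  forall a, {in gen_pred xs &, forall x y, a * x + y \in gen_pred xs}.
Proof.
split=> [|a x y].
  rewrite inE; apply/asboolP; exists (fun=> 0).
  by rewrite big1 // => i _; rewrite mul0r.
rewrite !inE => /asboolP[c ->] /asboolP[d ->]; apply/asboolP.
exists (fun i => a * c i + d i).
rewrite mulr_sumr -big_split /=; apply: eq_bigr => i _.
by rewrite mulrDl mulrA.
Qed.

Definition gen (xs : seq A) : ideal A := Ideal (gen_subproof xs).

Definition noetherian : Prop :=
  forall I : ideal A, exists xs : seq A, I =i gen xs.

Definition prime_ideal (P : ideal A) : Prop :=
  1 \notin P /\ forall u v, u * v \in P -> (u \in P) || (v \in P).

Definition maximal_ideal (M : ideal A) : Prop :=
  1 \notin M /\
  forall J : ideal A, {subset M <= J} -> 1 \notin J -> {subset J <= M}.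

Lemma adjoin_subproof (M : ideal A) (u : A) :
  let J := [pred y | `[< exists a, y - a * u \in M >]] in
  0 \in J /\ forall a, {in J &, forall x y, a * x + y \in J}.
Proof.
move=> J; split=> [|a x y].
  by rewrite inE; apply/asboolP; exists 0; rewrite mul0r subr0 ideal0.
rewrite !inE => /asboolP[b hb] /asboolP[c hc]; apply/asboolP.
exists (a * b + c).
suff -> : a * x + y - (a * b + c) * u = a * (x - b * u) + (y - c * u).
  exact: idealMD.
by rewrite mulrBr mulrDl opprD mulrA addrACA.
Qed.

Lemma maximal_prime (M : ideal A) : maximal_ideal M -> prime_ideal M.
Proof.
case=> M1 Mmax; split=> // u v uvM; apply/orP.
case: (boolP (u \in M)) => [|uM]; [by left | right].
pose J := Ideal (adjoin_subproof M u).
have MJ : {subset M <= J}.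
  by move=> y yM; rewrite inE; apply/asboolP; exists 0; rewrite mul0r subr0.
have uJ : u \in J.
  by rewrite inE; apply/asboolP; exists 1; rewrite mul1r subrr ideal0.
have : 1 \in J.
  by apply/negPn/negP => /(Mmax J MJ)/(_ u uJ); apply/negP.
rewrite inE => /asboolP[a ha].
have -> : v = v * (1 - a * u) + a * (u * v).
  by rewrite mulrBr mulr1 (mulrC v) mulrA subrK.
by rewrite idealMD // idealM.
Qed.

End Generated.

Record primeIdeal (A : comPzRingType) := PrimeIdeal {
  prime_val :> ideal A;
  primeP : prime_ideal prime_val
}.

Record maxIdeal (A : comPzRingType) := MaxIdeal {
  max_val : ideal A;
  maxP : maximal_ideal max_val
}.

Coercion max_prime (A : comPzRingType) (M : maxIdeal A) : primeIdeal A :=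
  PrimeIdeal (maximal_prime (maxP M)).

Section QuotientRing.
Variables (A : comPzRingType) (I : ideal A).

Definition quotient_ring : Type := Quotient.quot (ideal_pred I).
Local Notation Q := quotient_ring.

HB.instance Definition _ := GRing.Zmodule.on Q.
HB.instance Definition _ := EqQuotient.on Q.

Definition quot_proj (x : A) : Q := \pi_Q x.

Lemma quot_projE x y : (quot_proj x == quot_proj y) = (x - y \in I).
Proof. by rewrite /quot_proj -(Quotient.idealrBE (ideal_pred I)). Qed.

Definition quot_one : Q := quot_proj 1.
Definition quot_mul (x y : Q) : Q := quot_proj (repr x * repr y).

Lemma quot_projM x y : quot_proj (x * y) = quot_mul (quot_proj x) (quot_proj y).
Proof.
apply/eqP; rewrite /quot_mul quot_projE.
set x' := repr (quot_proj x); set y' := repr (quot_proj y).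
have hx : x - x' \in I by rewrite -quot_projE /x' /quot_proj reprK.
have hy : y - y' \in I by rewrite -quot_projE /y' /quot_proj reprK.
have -> : x * y - x' * y' = y * (x - x') + x' * (y - y').
  by rewrite !mulrBr (mulrC y) (mulrC y x') addrA subrK.
by rewrite idealMD // idealM.
Qed.

Lemma quot_projD x y : quot_proj (x + y) = quot_proj x + quot_proj y.
Proof. by rewrite /quot_proj !piE. Qed.

Lemma quot_reprK (x : Q) : quot_proj (repr x) = x.
Proof. by rewrite /quot_proj reprK. Qed.

Lemma quot_mulA : associative quot_mul.
Proof.
move=> x y z; rewrite -[x]quot_reprK -[y]quot_reprK -[z]quot_reprK.
by rewrite -!quot_projM mulrA.
Qed.

Lemma quot_mulC : commutative quot_mul.
Proof. by move=> x y; rewrite /quot_mul mulrC. Qed.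

Lemma quot_mul1 : left_id quot_one quot_mul.
Proof. by move=> x; rewrite -[x]quot_reprK -quot_projM mul1r. Qed.

Lemma quot_mulDl : left_distributive quot_mul +%R.
Proof.
move=> x y z; rewrite -[x]quot_reprK -[y]quot_reprK -[z]quot_reprK.
by rewrite -quot_projD -!quot_projM -quot_projD mulrDl.
Qed.

HB.instance Definition _ := GRing.Zmodule_isComPzRing.Build Q
  quot_mulA quot_mulC quot_mul1 quot_mulDl.

End QuotientRing.

(* The ring of fractions S^-1 A; a fraction a/s is encoded by a pair whose
   second component lies in the subtype of elements of S. *)
Section Localization.
Variables (A : comPzRingType) (S : mulrClosed A).

Local Notation den := {s : A | s \in S}.
Local Notation frac := (A * den)%type.

Definition loc_equiv (p q : frac) : bool :=
  `[< exists2 u, u \in S & u * (p.1 * val q.2 - q.1 * val p.2) = 0 >].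

Lemma loc_equiv_is_equiv : equiv_class_of loc_equiv.
Proof.
have sym p q : loc_equiv p q -> loc_equiv q p.
  move=> /asboolP[u uS e]; apply/asboolP; exists u => //.
  by rewrite -opprB mulrN e oppr0.
split=> [p|p q|q p r].
- by apply/asboolP; exists 1; rewrite ?rpred1 // subrr mulr0.
- by apply/idP/idP; exact: sym.
- move=> /asboolP[u uS e] /asboolP[v vS f]; apply/asboolP.
  exists (u * v * val q.2); first by rewrite !rpredM // (valP q.2).
  have -> : u * v * val q.2 * (p.1 * val r.2 - r.1 * val p.2) =
     v * val r.2 * (u * (p.1 * val q.2 - q.1 * val p.2))
     + u * val p.2 * (v * (q.1 * val r.2 - r.1 * val q.2)) by ring.
  by rewrite e f !mulr0 addr0.
Qed.

Canonical loc_equiv_equiv := EquivRelPack loc_equiv_is_equiv.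
Canonical loc_equiv_encModRel := defaultEncModRel loc_equiv.

Definition loc_ring : Type := {eq_quot loc_equiv}.
Local Notation L := loc_ring.

HB.instance Definition _ := Choice.on L.
HB.instance Definition _ := EqQuotient.on L.

Definition den1 : den := exist _ 1 (rpred1 S).
Definition denM (s t : den) : den :=
  exist _ (val s * val t) (rpredM (valP s) (valP t)).

Definition loc_frac (p : frac) : L := \pi_L p.

Lemma loc_fracP p q :
  loc_frac p = loc_frac q <->
  exists2 u, u \in S & u * (p.1 * val q.2 - q.1 * val p.2) = 0.
Proof.
rewrite /loc_frac; split=> [/eqmodP /asboolP //|h].
by apply/eqmodP/asboolP.
Qed.

Lemma loc_reprK (x : L) : loc_frac (repr x) = x.
Proof. by rewrite /loc_frac reprK. Qed.

Definition frac_add (p q : frac) : frac :=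
  (p.1 * val q.2 + q.1 * val p.2, denM p.2 q.2).
Definition frac_opp (p : frac) : frac := (- p.1, p.2).
Definition frac_mul (p q : frac) : frac := (p.1 * q.1, denM p.2 q.2).

Definition loc_zero : L := loc_frac (0, den1).
Definition loc_one : L := loc_frac (1, den1).
Definition loc_add (x y : L) : L := loc_frac (frac_add (repr x) (repr y)).
Definition loc_opp (x : L) : L := loc_frac (frac_opp (repr x)).
Definition loc_mul (x y : L) : L := loc_frac (frac_mul (repr x) (repr y)).

Lemma loc_addE p q :
  loc_add (loc_frac p) (loc_frac q) = loc_frac (frac_add p q).
Proof.
rewrite /loc_add; set p' := repr _; set q' := repr _.
have /loc_fracP[u uS e] : loc_frac p' = loc_frac p by exact: loc_reprK.
have /loc_fracP[v vS f] : loc_frac q' = loc_frac q by exact: loc_reprK.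
apply/loc_fracP; exists (u * v); rewrite ?rpredM //=.
transitivity (v * val q.2 * val q'.2 * (u * (p'.1 * val p.2 - p.1 * val p'.2))
  + u * val p.2 * val p'.2 * (v * (q'.1 * val q.2 - q.1 * val q'.2))).
  by rewrite /=; ring.
by rewrite e f !mulr0 addr0.
Qed.

Lemma loc_oppE p : loc_opp (loc_frac p) = loc_frac (frac_opp p).
Proof.
rewrite /loc_opp; set p' := repr _.
have /loc_fracP[u uS e] : loc_frac p' = loc_frac p by exact: loc_reprK.
apply/loc_fracP; exists u => //=.
by rewrite !mulNr -opprD mulrN e oppr0.
Qed.

Lemma loc_mulE p q :
  loc_mul (loc_frac p) (loc_frac q) = loc_frac (frac_mul p q).
Proof.
rewrite /loc_mul; set p' := repr _; set q' := repr _.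
have /loc_fracP[u uS e] : loc_frac p' = loc_frac p by exact: loc_reprK.
have /loc_fracP[v vS f] : loc_frac q' = loc_frac q by exact: loc_reprK.
apply/loc_fracP; exists (u * v); rewrite ?rpredM //=.
transitivity (v * q'.1 * val q.2 * (u * (p'.1 * val p.2 - p.1 * val p'.2))
  + u * p.1 * val p'.2 * (v * (q'.1 * val q.2 - q.1 * val q'.2))).
  by rewrite /=; ring.
by rewrite e f !mulr0 addr0.
Qed.

Lemma loc_frac_eq p q :
  p.1 * val q.2 = q.1 * val p.2 -> loc_frac p = loc_frac q.
Proof.
by move=> e; apply/loc_fracP; exists 1; rewrite ?rpred1 // e subrr mulr0.
Qed.

Lemma loc_addA : associative loc_add.
Proof.
move=> x y z; rewrite -[x]loc_reprK -[y]loc_reprK -[z]loc_reprK !loc_addE.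
by apply: loc_frac_eq => /=; ring.
Qed.

Lemma loc_addC : commutative loc_add.
Proof.
move=> x y; rewrite -[x]loc_reprK -[y]loc_reprK !loc_addE.
by apply: loc_frac_eq => /=; ring.
Qed.

Lemma loc_add0 : left_id loc_zero loc_add.
Proof.
move=> x; rewrite -[x]loc_reprK /loc_zero loc_addE.
by apply: loc_frac_eq => /=; ring.
Qed.

Lemma loc_addN : left_inverse loc_zero loc_opp loc_add.
Proof.
move=> x; rewrite -[x]loc_reprK loc_oppE loc_addE.
by apply: loc_frac_eq => /=; ring.
Qed.

HB.instance Definition _ :=
  GRing.isZmodule.Build L loc_addA loc_addC loc_add0 loc_addN.

Lemma loc_mulA : associative loc_mul.
Proof.
move=> x y z; rewrite -[x]loc_reprK -[y]loc_reprK -[z]loc_reprK !loc_mulE.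
by apply: loc_frac_eq => /=; ring.
Qed.

Lemma loc_mulC : commutative loc_mul.
Proof.
move=> x y; rewrite -[x]loc_reprK -[y]loc_reprK !loc_mulE.
by apply: loc_frac_eq => /=; ring.
Qed.

Lemma loc_mul1 : left_id loc_one loc_mul.
Proof.
move=> x; rewrite -[x]loc_reprK /loc_one loc_mulE.
by apply: loc_frac_eq => /=; ring.
Qed.

Lemma loc_mulDl : left_distributive loc_mul loc_add.
Proof.
move=> x y z; rewrite -[x]loc_reprK -[y]loc_reprK -[z]loc_reprK.
rewrite loc_addE !loc_mulE loc_addE.
by apply: loc_frac_eq => /=; ring.
Qed.

HB.instance Definition _ :=
  GRing.Zmodule_isComPzRing.Build L loc_mulA loc_mulC loc_mul1 loc_mulDl.

End Localization.

Section PrimeComplement.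
Variables (A : comPzRingType) (P : primeIdeal A).

Definition prime_compl : {pred A} := [pred x | x \notin P].

Lemma prime_compl_mulr_closed : mulr_closed prime_compl.
Proof.
case: (primeP P) => P1 PM; split=> [|x y]; first by rewrite inE.
rewrite !inE => xP yP; apply/negP => /PM.
by rewrite (negPf xP) (negPf yP).
Qed.

HB.instance Definition _ :=
  GRing.isMulClosed.Build A prime_compl prime_compl_mulr_closed.

Definition localization_at := loc_ring prime_compl.

End PrimeComplement.

Section TotalQuotient.
Variable A : comPzRingType.

Definition non_zero_divisor (x : A) : Prop := forall y, x * y = 0 -> y = 0.

Definition nzd_pred : {pred A} := [pred x | `[< non_zero_divisor x >]].

Lemma nzd_mulr_closed : mulr_closed nzd_pred.
Proof.
split=> [|x y].
  by rewrite inE; apply/asboolP => y; rewrite mul1r.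
rewrite !inE => /asboolP hx /asboolP hy; apply/asboolP => z.
by rewrite -mulrA => /hx /hy.
Qed.

HB.instance Definition _ :=
  GRing.isMulClosed.Build A nzd_pred nzd_mulr_closed.

Definition total_quotient := loc_ring nzd_pred.

End TotalQuotient.

HB.instance Definition _ (A : comPzRingType) (P : primeIdeal A) :=
  GRing.ComPzRing.on (localization_at P).
HB.instance Definition _ (A : comPzRingType) :=
  GRing.ComPzRing.on (total_quotient A).

Section Modules.
Variable A : comPzRingType.

(* M (x) N is presented as the commutative monoid of formal sums of pure
   tensors (m, n), that is finite sequences up to reordering, modulo the least
   congruence making (m, n) bilinear and balanced. The quotient is a group,
   since (- m, n) becomes opposite to (m, n). *)
Inductive tensor_eq (M N : lmodType A) : seq (M * N) -> seq (M * N) -> Prop :=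
| tensor_refl s : tensor_eq s s
| tensor_sym s t : tensor_eq s t -> tensor_eq t s
| tensor_trans s t u : tensor_eq s t -> tensor_eq t u -> tensor_eq s u
| tensor_cat s t s' t' :
    tensor_eq s t -> tensor_eq s' t' -> tensor_eq (s ++ s') (t ++ t')
| tensor_catC s t : tensor_eq (s ++ t) (t ++ s)
| tensor_0l n : tensor_eq [:: (0, n)] [::]
| tensor_Dl m m' n : tensor_eq [:: (m + m', n)] [:: (m, n); (m', n)]
| tensor_Dr m n n' : tensor_eq [:: (m, n + n')] [:: (m, n); (m, n')]
| tensor_Z a m n : tensor_eq [:: (a *: m, n)] [:: (m, a *: n)].

Definition tensor_map (M N N' : lmodType A) (f : N -> N') (s : seq (M * N)) :
  seq (M * N') := [seq (p.1, f p.2) | p <- s].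

(* The functor M (x) - preserves injectivity. *)
Definition flat (M : lmodType A) : Prop :=
  forall (N N' : lmodType A) (f : {linear N -> N'}), injective f ->
  forall s t : seq (M * N),
    tensor_eq (tensor_map f s) (tensor_map f t) -> tensor_eq s t.

Definition projective (M : lmodType A) : Prop :=
  forall (N N' : lmodType A) (g : {linear N -> N'}) (f : {linear M -> N'}),
    (forall y, exists x, g x = y) ->
    exists h : {linear M -> N}, forall m, g (h m) = f m.

Definition perfect : Prop := forall M : lmodType A, flat M -> projective M.

End Modules.

Definition subperfect (A : comPzRingType) : Prop := perfect (total_quotient A).

Section RegularSequences.
Variable A : comPzRingType.

(* The empty sequence is regular even in the zero ring. *)
Definition regular_seq (xs : seq A) : Prop :=
  (xs <> [::] -> ~ (gen xs =i predT)) /\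
  forall j, (j < size xs)%N ->
    non_zero_divisor (quot_proj (gen (take j xs)) xs`_j).

Definition maximal_regular_seq (xs : seq A) : Prop :=
  regular_seq xs /\ forall x, ~ regular_seq (rcons xs x).

Definition regularly_subperfect : Prop :=
  forall xs, regular_seq xs -> subperfect (quotient_ring (gen xs)).

Definition n_subperfect (n : nat) : Prop :=
  regularly_subperfect /\ forall xs, maximal_regular_seq xs -> size xs = n.

End RegularSequences.

(* Suprema of sets of lengths are relations [D n], "the supremum is the finite
   number n"; no n satisfies it when the set is empty or unbounded. *)
Definition greatest (D : nat -> Prop) (n : nat) : Prop :=
  D n /\ forall k, D k -> (k <= n)%N.

Section Dimension.
Variable A : comPzRingType.

Definition prime_chain (n : nat) (p : nat -> ideal A) : Prop :=
  (forall i, (i <= n)%N -> prime_ideal (p i)) /\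
  (forall i, (i < n)%N -> {subset p i <= p i.+1} /\ ~ (p i =i p i.+1)).

Definition has_height (P : ideal A) (n : nat) : Prop :=
  greatest (fun k => exists2 p, prime_chain k p & p k =i P) n.

Definition has_krull_dim (n : nat) : Prop :=
  greatest (fun k => exists p, prime_chain k p) n.

Definition has_depth (I : ideal A) (n : nat) : Prop :=
  greatest (fun k => exists xs,
    [/\ regular_seq xs, {subset xs <= I} & size xs = k]) n.

Definition cohen_macaulay_local : Prop :=
  noetherian A /\
  exists m : ideal A,
    [/\ maximal_ideal m,
        forall m' : ideal A, maximal_ideal m' -> m' =i m
      & exists d, has_depth m d /\ has_krull_dim d].

End Dimension.

Definition cohen_macaulay (A : comPzRingType) : Prop :=
  noetherian A /\
  forall M : maxIdeal A, cohen_macaulay_local (localization_at M).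

(* Main.v *)
From HB Require Import structures.
Require Import Defs.
From mathcomp Require Import boolp classical_sets functions.
From mathcomp Require Import all_boot all_algebra ring zify.

Set Implicit Arguments.
Unset Strict Implicit.
Unset Printing Implicit Defensive.

Import GRing.Theory.

Local Open Scope ring_scope.
Local Open Scope quotient_scope.

(** Everything is phrased inside one ring, relative to ideals, so that no ring
    is ever an iterated quotient.

    Perfection enters through its ring-theoretic shadow. If flat modules over
    [B] are projective, then so is [B[1/b]], and lifting its generators to
    sequences of elements of [B] forces [b ^+ k = b ^+ k.+1 * c] for some [k]
    and [c] ([perfect_pi_regular]). Conversely a noetherian ring with that
    property is a finite product of local rings with nilpotent maximal ideals,
    over which a flat module is free on any lift of a basis of its residue
    space ([pi_regular_perfect]). For the total quotient ring of [A / I] this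
    becomes the condition [frac_zero_dim I] on elements of [A] ([subperfectP]);
    it holds as soon as all primes [(I : b)] are minimal over [I]
    ([unmixed_frac_zero_dim]).

    A Cohen-Macaulay local ring satisfies it for [I] generated by a regular
    sequence of length [n]. A prime [P = (I : b)] lies below a chain of at least
    [d - n] further primes, [d] being the depth, because that many regular
    elements remain ([exchange_seq], [chain_above]); any prime above [I] lies
    above a chain of [n] primes, one for each term of the sequence
    ([chain_below]). If [P] were not minimal over [I], putting the two chains
    together would give a chain longer than the dimension, which is [d]
    ([cm_frac_zero_dim]). The non-local case follows by localizing at a maximal
    ideal above [P].

    Assume now that the ring is regularly subperfect. A prime properly above a
    prime over [I] contains a non-zero-divisor modulo [I]. Going up a chain of
    primes that ends at [M], one therefore collects a regular sequence in [M] as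
    long as the chain ([regular_of_chain]), and all maximal regular sequences in
    [M] have the same length by the exchange lemma ([size_maximal_in]). Hence a
    maximal regular sequence in [M] computes the height of [M]. Its image
    in the localization at [M] is a regular sequence as long as any chain of
    primes there, which is the local Cohen-Macaulay property ([cm_dataP]). The
    same count inside the localization recovers Cohen-Macaulayness from the
    local subperfect condition. *)

(** * Ideals *)

(** Ideals are predicates into [bool], so extensionality makes them equal as
    records; this lets identities such as [adjoinC] be used for rewriting. *)
Lemma ideal_ext (A : comPzRingType) (I J : ideal A) : I =i J -> I = J.
Proof.
case: I J => [I hI] [J hJ] /= e.
have eIJ : I = J by apply/funext => x; exact: e.
by subst J; congr Ideal; apply: Prop_irrelevance.
Qed.

Section Ideals.
Variable A : comPzRingType.
Implicit Types (I J K P Q M : ideal A) (x y z : A) (xs ys zs : seq A).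

Lemma ideal_sub_anti I J : {subset I <= J} -> {subset J <= I} -> I = J.
Proof.
by move=> IJ JI; apply: ideal_ext => x; apply/idP/idP; [apply: IJ|apply: JI].
Qed.

Definition adjoin I x : ideal A := Ideal (adjoin_subproof I x).

Lemma adjoinP I x y : reflect (exists a, y - a * x \in I) (y \in adjoin I x).
Proof. by rewrite inE; apply: asboolP. Qed.

Lemma sub_adjoin I x : {subset I <= adjoin I x}.
Proof. by move=> y yI; apply/adjoinP; exists 0; rewrite mul0r subr0. Qed.

Lemma mem_adjoin I x : x \in adjoin I x.
Proof. by apply/adjoinP; exists 1; rewrite mul1r subrr ideal0. Qed.

Lemma adjoin_min I J x : {subset I <= J} -> x \in J -> {subset adjoin I x <= J}.
Proof.
move=> IJ xJ y /adjoinP[a /IJ h].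
by rewrite -(subrK (a * x) y) addrC idealMD.
Qed.

Lemma adjoinC I x y : adjoin (adjoin I x) y = adjoin (adjoin I y) x.
Proof.
have h u v : {subset adjoin (adjoin I u) v <= adjoin (adjoin I v) u}.
  apply: adjoin_min; last by apply: sub_adjoin; apply: mem_adjoin.
  apply: adjoin_min; last exact: mem_adjoin.
  by move=> w wI; do 2!apply: sub_adjoin.
by apply: ideal_sub_anti.
Qed.

Lemma colon_subproof I b : let J := [pred y | y * b \in I] in
  0 \in J /\ forall a, {in J &, forall x y, a * x + y \in J}.
Proof.
split=> [|a x y]; rewrite !inE ?mul0r ?ideal0 // => xI yI.
by rewrite mulrDl -mulrA idealMD.
Qed.

Definition colon I b : ideal A := Ideal (colon_subproof I b).

Lemma colonE I b y : (y \in colon I b) = (y * b \in I).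
Proof. by rewrite inE. Qed.

Lemma sub_colonM I b c : {subset colon I b <= colon I (c * b)}.
Proof. by move=> y; rewrite !colonE mulrCA => /idealM. Qed.

Lemma sub_colon I b : {subset I <= colon I b}.
Proof. by move=> y yI; rewrite colonE mulrC idealM. Qed.

Lemma primeM P x y : prime_ideal P -> (x * y \in P) = (x \in P) || (y \in P).
Proof.
case=> _ hP; apply/idP/orP; first by move/hP/orP.
by case=> h; [rewrite mulrC|]; apply: (idealM _ h).
Qed.

Lemma primeX P x n : prime_ideal P -> x ^+ n \in P -> x \in P.
Proof.
move=> hP; elim: n => [|n IHn]; first by rewrite expr0; case: hP => /negPf->.
by rewrite exprS primeM // => /orP[].
Qed.

Lemma mem_gen xs x : x \in xs -> x \in gen xs.
Proof.
move=> xxs; rewrite inE; apply/asboolP.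
have h : (index x xs < size xs)%N by rewrite index_mem.
exists (fun i => (i == Ordinal h)%:R).
rewrite (bigD1 (Ordinal h)) //= eqxx mul1r nth_index // big1 ?addr0 // => i.
by move/negPf->; rewrite mul0r.
Qed.

Lemma mem_genP xs y : y \in gen xs ->
  exists d : nat -> A, y = \sum_(i < size xs) d i * xs`_i.
Proof.
rewrite inE => /asboolP[c ->].
exists (fun i => if insub i is Some j then c j else 0).
by apply: eq_bigr => i _; rewrite valK.
Qed.

Lemma gen_min xs I : {subset xs <= I} -> {subset gen xs <= I}.
Proof.
move=> h y; rewrite inE => /asboolP[c ->].
by apply: rpred_sum => i _; apply/idealM/h; rewrite mem_nth.
Qed.

Lemma gen_sub xs ys : {subset xs <= ys} -> {subset gen xs <= gen ys}.
Proof. by move=> h; apply: gen_min => x xxs; apply/mem_gen/h. Qed.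

Lemma gen_rcons xs x : gen (rcons xs x) = adjoin (gen xs) x.
Proof.
apply: ideal_sub_anti.
  apply: gen_min => y; rewrite mem_rcons inE => /orP[/eqP->|h].
    exact: mem_adjoin.
  by apply/sub_adjoin/mem_gen.
apply: adjoin_min; last by apply: mem_gen; rewrite mem_rcons mem_head.
by apply: gen_sub => y yxs; rewrite mem_rcons inE yxs orbT.
Qed.

Lemma gen0 x : (x \in gen [::]) = (x == 0).
Proof.
apply/idP/eqP=> [|->]; last exact: ideal0.
by rewrite inE => /asboolP[c ->]; rewrite big_ord0.
Qed.

(** * Noetherian rings *)

(** Noetherian induction: a counterexample would start a strictly increasing
    sequence of ideals, whose union could not be finitely generated. *)
Lemma noetherian_ind (noA : noetherian A) (T : ideal A -> Prop) :
  (forall I, (forall J, {subset I <= J} -> ~ {subset J <= I} -> T J) -> T I) ->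
  forall I, T I.
Proof.
move=> step I0; apply: contrapT => nT0.
have next (s : {I | ~ T I}) :
    {t : {I | ~ T I} | {subset sval s <= sval t} /\
                       ~ {subset sval t <= sval s}}.
  apply: cid; apply: contrapT => h; apply: (svalP s); apply: step.
  move=> J IJ JI; apply: contrapT => nTJ; apply: h.
  by exists (exist _ J nTJ).
pose s n := iter n (fun t => sval (next t)) (exist _ I0 nT0).
pose I n := sval (s n).
have IS n : {subset I n <= I n.+1} /\ ~ {subset I n.+1 <= I n}.
  by rewrite /I /=; case: (next (s n)).
have Imono m n : (m <= n)%N -> {subset I m <= I n}.
  move=> mn; rewrite -(subnKC mn).
  elim: (n - m)%N => [|k IHk]; first by rewrite addn0.
  by move=> x /IHk; rewrite addnS; case: (IS (m + k)%N) => h _; apply: h.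
pose U := [pred x | `[< exists n, x \in I n >]].
have hU : 0 \in U /\ forall a, {in U &, forall x y, a * x + y \in U}.
  split=> [|a x y]; rewrite !inE.
    by apply/asboolP; exists 0%N; apply: ideal0.
  move=> /asboolP[m xm] /asboolP[n yn]; apply/asboolP; exists (maxn m n).
  by apply: idealMD; [apply: Imono xm; rewrite leq_maxl
                     | apply: Imono yn; rewrite leq_maxr].
have [xs Uxs] := noA (Ideal hU).
have [n xsn] : exists n, {subset xs <= I n}.
  have : {subset xs <= Ideal hU} by move=> x /mem_gen; rewrite Uxs.
  elim: {Uxs} xs => [|x xs IHxs] h; first by exists 0%N.
  have [n hn] : exists n, {subset xs <= I n}.
    by apply: IHxs => y yxs; apply: h; rewrite inE yxs orbT.
  have := h x (mem_head _ _); rewrite inE => /asboolP[m xm].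
  exists (maxn m n) => y; rewrite inE => /orP[/eqP->|/hn yn].
    by apply: Imono xm; rewrite leq_maxl.
  by apply: Imono yn; rewrite leq_maxr.
case: (IS n) => _; apply=> x xSn; apply: (gen_min xsn); rewrite -Uxs inE.
by apply/asboolP; exists n.+1.
Qed.

(** The maximal condition for a family of ideals [K t] indexed by the [t] in [F];
    the maximal ideal is wanted together with its index. *)
Lemma noetherian_max (noA : noetherian A) (T : Type) (F : T -> Prop)
    (K : T -> ideal A) (t0 : T) : F t0 ->
  exists t, [/\ F t, {subset K t0 <= K t} &
    forall u, F u -> {subset K t <= K u} -> {subset K u <= K t}].
Proof.
move: {2}(K t0) (erefl (K t0)) => I e.
elim/(noetherian_ind noA): I t0 e => I IH t e Ft.
have [h|/existsNP[u /not_implyP[Fu /not_implyP[tu ut]]]] :=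
  pselect (forall u, F u -> {subset K t <= K u} -> {subset K u <= K t}).
  by exists t; split.
rewrite -e in IH; have [v [Fv uv vmax]] := IH (K u) tu ut u erefl Fu.
by exists v; split=> // x /tu /uv.
Qed.

(** An ideal maximal among those disjoint from a multiplicative set is prime. *)
Lemma prime_avoiding (noA : noetherian A) I (S : A -> Prop) :
  S 1 -> (forall x y, S x -> S y -> S (x * y)) ->
  (forall x, S x -> x \notin I) ->
  exists P, [/\ prime_ideal P, {subset I <= P} & forall x, S x -> x \notin P].
Proof.
move=> S1 SM SI.
have [P [PS IP Pmax]] := @noetherian_max noA _
  (fun J => forall x, S x -> x \notin J) (fun J => J) I SI.
exists P; split=> //; split; first exact: PS.
move=> u v uvP; apply: contrapT => /negP; rewrite negb_or => /andP[uP vP].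
have meets w : w \notin P -> exists2 s, S s & s \in adjoin P w.
  move=> wP; apply: contrapT => h; move/negP: wP; apply.
  apply: (Pmax (adjoin P w)); [|exact: sub_adjoin|exact: mem_adjoin].
  by move=> x Sx; apply/negP => xP; apply: h; exists x.
have [s Ss /adjoinP[a ha]] := meets u uP.
have [t St /adjoinP[b hb]] := meets v vP.
have /negP := PS _ (SM _ _ Ss St); apply.
have -> : s * t =
  t * (s - a * u) + (a * u * (t - b * v) + a * b * (u * v)) by ring.
by rewrite idealMD // idealMD // idealM.
Qed.

Lemma exists_maximal (noA : noetherian A) I : 1 \notin I ->
  exists2 M, maximal_ideal M & {subset I <= M}.
Proof.
move=> I1; have [M [M1 IM Mmax]] := @noetherian_max noA _
  (fun J => 1 \notin J) (fun J => J) I I1.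
by exists M => //; split=> // J MJ J1; apply: Mmax.
Qed.

(** The set of all [s * x ^+ k] with [s] outside [P] is multiplicative; a prime
    that avoids it is contained in [P] and misses [x]. This replaces the choice
    of a prime minimal over [I]. *)
Lemma prime_below (noA : noetherian A) I P x : prime_ideal P ->
  (forall s k, s \notin P -> s * x ^+ k \notin I) ->
  exists Q, [/\ prime_ideal Q, {subset I <= Q}, {subset Q <= P} & x \notin Q].
Proof.
move=> hP h.
have [|y z|y|Q [hQ IQ QS]] := @prime_avoiding noA I
   (fun y => exists s k, s \notin P /\ y = s * x ^+ k).
- by exists 1, 0%N; rewrite expr0 mulr1; case: hP.
- move=> [s [k [sP ->]]] [t [l [tP ->]]]; exists (s * t), (k + l)%N.
  by rewrite exprD mulrACA primeM // negb_or sP tP.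
- by move=> [s [k [sP ->]]]; apply: h.
exists Q; split=> //.
  move=> y yQ; apply: contrapT => /negP yP.
  have /negP[] : y \notin Q by apply: QS; exists y, 0%N; rewrite expr0 mulr1.
  by [].
by apply: QS; exists 1, 1%N; rewrite mul1r expr1; case: hP.
Qed.

(** Maximal annihilators are prime; only multiples of [b] have to be compared. *)
Lemma colon_max_prime I b : b \notin I ->
  (forall c, c * b \notin I -> {subset colon I (c * b) <= colon I b}) ->
  prime_ideal (colon I b).
Proof.
move=> bI bmax; split; first by rewrite colonE mul1r.
move=> u v; rewrite !colonE => uvb.
case: (boolP (v * b \in I)) => [_|vb]; first by rewrite orbT.
by rewrite orbF -colonE; apply: (bmax v) => //; rewrite colonE mulrA.
Qed.

(** Associated primes lie above any proper annihilator: take a multiple of [b]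
    outside [I] whose annihilator is maximal. *)
Lemma exists_prime_colon (noA : noetherian A) I b : b \notin I ->
  exists c, [/\ c * b \notin I, prime_ideal (colon I (c * b)) &
                {subset colon I b <= colon I (c * b)}].
Proof.
move=> bI; have [|c [cI _ cmax]] := @noetherian_max noA _
  (fun c => c * b \notin I) (fun c => colon I (c * b)) 1.
  by rewrite mul1r.
exists c; split=> //; last exact: sub_colonM.
apply: colon_max_prime => // d dI; rewrite mulrA; apply: cmax.
  by rewrite -mulrA.
by rewrite -mulrA; apply: sub_colonM.
Qed.

End Ideals.

(** * Zero divisors and prime avoidance *)

Section Avoidance.
Variable A : comPzRingType.
Implicit Types (I J K P Q M : ideal A) (x y z : A).

(** Non-zero-divisors modulo [I]; if [I] is the whole ring, all elements qualify. *)
Definition nzd_mod I x := forall y, x * y \in I -> y \in I.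

Lemma prime_inter (T : eqType) (s : seq T) (K : T -> ideal A) P :
  prime_ideal P ->
  (forall x, {in s, forall t, x \in K t} -> x \in P) ->
  exists2 t, t \in s & {subset K t <= P}.
Proof.
move=> hP; elim: s => [|t s IHs] h.
  by case: hP => /negP[]; apply: h.
have [tP|/existsNP[x /not_implyP[xt /negP xP]]] := pselect {subset K t <= P}.
  by exists t; rewrite ?mem_head.
have [|u us uP] := IHs; last by exists u; rewrite // inE us orbT.
move=> y ys; have : x * y \in P.
  apply: h => u; rewrite inE => /orP[/eqP->|/ys h]; last exact: idealM.
  by rewrite mulrC idealM.
by rewrite primeM // (negPf xP).
Qed.

(** Induction on the number of primes. If the head [K t] does not contain [J] and
    is needed for the covering, some [K u] of the tail lies below it, and [u] can
    be dropped. Indeed, otherwise the tail meets in an element [w] outside [K t],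
    and [z + w * v] escapes all the primes. *)
Lemma prime_avoidance (T : eqType) (s : seq T) (K : T -> ideal A) J :
  {in s, forall t, prime_ideal (K t)} ->
  {in J, forall z, exists2 t, t \in s & z \in K t} ->
  exists2 t, t \in s & {subset J <= K t}.
Proof.
have [n] := ubnP (size s); elim: n s => // n IHn [|t s] /= sn Kpr Jcov.
  by case: (Jcov 0 (ideal0 J)).
have [Js|/existsNP[z /not_implyP[zJ zs]]] :=
    pselect {in J, forall z, exists2 t, t \in s & z \in K t}.
  have [//|u us|u us Ju] := IHn s _ _ Js.
    by apply: Kpr; rewrite inE us orbT.
  by exists u; rewrite // inE us orbT.
have zt : z \in K t.
  have [u] := Jcov z zJ; rewrite inE => /orP[/eqP->//|us zu].
  by case: zs; exists u.
have [Jt|/existsNP[v /not_implyP[vJ /negP vt]]] := pselect {subset J <= K t}.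
  by exists t; rewrite ?mem_head.
have [u us ut] : exists2 u, u \in s & {subset K u <= K t}.
  apply: prime_inter; first by apply: Kpr; rewrite mem_head.
  move=> w ws; apply: contrapT => /negP wt.
  have [u] := Jcov (z + w * v) (rpredD zJ (idealM w vJ)).
  rewrite inE => /orP[/eqP->|us].
    rewrite rpredDl // primeM ?(negPf wt) ?(negPf vt) //.
    by apply: Kpr; rewrite mem_head.
  rewrite rpredDr => [zu|]; first by case: zs; exists u.
  by rewrite mulrC idealM // ws.
pose s' := [seq x <- s | x != u].
have [||y vJ'|y] := IHn (t :: s').
- rewrite /= size_filter; apply: (@leq_trans (size s).+1) sn; rewrite ltnS.
  rewrite -(count_predC (pred1 u) s) -[X in (X < _)%N]add0n ltn_add2r.
  by rewrite -has_count has_pred1.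
- move=> x; rewrite inE => /orP[/eqP->|]; first by apply: Kpr; rewrite mem_head.
  by rewrite mem_filter => /andP[_ xs]; apply: Kpr; rewrite inE xs orbT.
- have [x] := Jcov y vJ'; rewrite inE => /orP[/eqP-> yt|xs yx].
    by exists t; rewrite ?mem_head.
  have [xu|xu] := eqVneq x u; first by exists t; rewrite ?mem_head // ut // -xu.
  by exists x => //; rewrite inE mem_filter xu xs orbT.
- rewrite inE => /orP[/eqP->|]; first by exists t; rewrite ?mem_head.
  by rewrite mem_filter => /andP[_ ys] Jy; exists y; rewrite // inE ys orbT.
Qed.

(** Finiteness of the set of maximal associated primes. The elements [b] with
    maximal annihilator generate a finitely generated ideal; an annihilator of a
    combination of [b_1, ..., b_r] contains the intersection of theirs, so being
    prime it contains one of them, and equals it by maximality. *)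
Lemma zero_divisors_primes (noA : noetherian A) I :
  exists bs : seq A,
    {in bs, forall b, b \notin I /\ prime_ideal (colon I b)} /\
    forall z, ~ nzd_mod I z -> exists2 b, b \in bs & z \in colon I b.
Proof.
pose Mx b := b \notin I /\ forall c, c \notin I ->
  {subset colon I b <= colon I c} -> {subset colon I c <= colon I b}.
have [|bs [bsMx _ bsmax]] := @noetherian_max A noA (seq A)
  (fun bs => {in bs, forall b, Mx b}) (@gen A) [::]; first by [].
have Mxpr b : Mx b -> prime_ideal (colon I b).
  move=> [bI bmax]; apply: colon_max_prime => // c cI; apply: bmax => //.
  exact: sub_colonM.
exists bs; split=> [b /bsMx bM|z]; first by split; [case: bM | apply: Mxpr].
move=> /existsNP[y /not_implyP[zy /negP yI]].
have [|b [[bI yb] _ bmax]] := @noetherian_max A noA A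
  (fun c => c \notin I /\ {subset colon I y <= colon I c}) (colon I) y.
  by split.
have bM : Mx b.
  by split=> // c cI bc; apply: bmax => //; split=> // x /yb /bc.
have bgen : b \in gen bs.
  apply: (bsmax (b :: bs)); last by apply/mem_gen/mem_head.
    by move=> c; rewrite inE => /orP[/eqP->//|]; apply: bsMx.
  by apply: gen_sub => c cbs; rewrite inE cbs orbT.
have [|c cbs cb] := @prime_inter _ bs (colon I) _ (Mxpr _ bM).
  move=> x xbs; rewrite colonE mulrC.
  suff: b \in colon I x by rewrite colonE.
  by apply: (gen_min _ bgen) => c /xbs; rewrite !colonE mulrC.
exists c => //; case: (bsMx c cbs) => _ cmax; apply: (cmax b) => //.
by apply: yb; rewrite colonE.
Qed.

(** Prime avoidance, applied to the maximal associated primes of all the [K i]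
    together. *)
Lemma exists_nzd_mod (noA : noetherian A) (K : nat -> ideal A) n J :
  (exists2 z, z \in J & forall i, (i < n)%N -> nzd_mod (K i) z) \/
  exists i b, [/\ (i < n)%N, b \notin K i & {in J, forall z, z * b \in K i}].
Proof.
have [bs hbs] := choice (fun i => zero_divisors_primes noA (K i)).
pose s := [seq (i, b) | i <- iota 0 n, b <- bs i].
have [Jcov|/existsNP[z /not_implyP[zJ zs]]] := pselect {in J, forall z,
    exists2 p, p \in s & z \in colon (K p.1) p.2}; [right|left].
  have [|p ps Jp] := prime_avoidance _ Jcov.
    by move=> p /allpairsPdep[i [b [_ bi ->]]] /=; case: (hbs i) => /(_ b bi)[].
  move: ps Jp => /allpairsPdep[i [b [iin bi ->]]] /= Jp.
  exists i, b; split; first by move: iin; rewrite mem_iota.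
    by case: (hbs i) => /(_ b bi)[].
  by move=> w /Jp; rewrite colonE.
exists z => // i ilt; apply: contrapT => nz; apply: zs.
case: (hbs i) => _ /(_ z nz)[b bi zb]; exists (i, b) => //.
by apply/allpairsPdep; exists i, b; rewrite mem_iota.
Qed.

End Avoidance.

(** * Regular sequences modulo an ideal *)

Section Regular.
Variable A : comPzRingType.
Implicit Types (I J K P Q M : ideal A) (x y z : A) (xs ys zs : seq A).

(** Regular sequences modulo [I], without the condition that the ideal they
    generate be proper, which is automatic for sequences inside a proper ideal. *)
Fixpoint regular_mod I xs : Prop :=
  if xs is x :: xs' then nzd_mod I x /\ regular_mod (adjoin I x) xs' else True.

Definition adjoins I xs := foldl (@adjoin A) I xs.

Lemma sub_adjoins I xs : {subset I <= adjoins I xs}.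
Proof.
by elim: xs I => [|x xs IHxs] I //= y yI; apply/IHxs/sub_adjoin.
Qed.

Lemma mem_adjoins I xs : {subset xs <= adjoins I xs}.
Proof.
elim: xs I => [|x xs IHxs] I y //=; rewrite inE => /orP[/eqP->|/IHxs//].
exact/sub_adjoins/mem_adjoin.
Qed.

Lemma adjoins_gen xs ys : adjoins (gen xs) ys = gen (xs ++ ys).
Proof.
elim: ys xs => [|y ys IHys] xs; first by rewrite cats0.
by rewrite /= -gen_rcons IHys cat_rcons.
Qed.

Lemma regular_mod_cat I xs ys : regular_mod I (xs ++ ys) <->
  regular_mod I xs /\ regular_mod (adjoins I xs) ys.
Proof. by elim: xs I => [|x xs IHxs] I /=; rewrite ?IHxs; intuition. Qed.

(** [z, x] is regular when [x, z] is, provided [z] is a non-zero-divisor to start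
    with; over a general ring this last condition cannot be dropped. *)
Lemma nzd_mod_swap I x z :
  nzd_mod I x -> nzd_mod I z -> nzd_mod (adjoin I x) z -> nzd_mod (adjoin I z) x.
Proof.
move=> xI zI zx a /adjoinP[b hb].
have /zx/adjoinP[c hc] : z * b \in adjoin I x.
  apply/adjoinP; exists a; have -> : z * b - a * x = - (x * a - b * z) by ring.
  by rewrite rpredN.
apply/adjoinP; exists c; apply: xI.
have -> : x * (a - c * z) = (x * a - b * z) + z * (b - c * x) by ring.
by rewrite rpredD ?idealM.
Qed.

(** Dividing by one regular element of [J] lowers the length of regular
    sequences in [J] by at most one. The element [x] is compared with the first
    term [y1] through an auxiliary [z] that is regular modulo [I], [I + x] and
    [I + y1] at the same time: modulo [I + y1] and then modulo [I + z], induction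
    applies to shorter sequences. *)
Lemma exchange (noA : noetherian A) I J x ys :
  regular_mod I ys -> {subset ys <= J} -> x \in J -> nzd_mod I x ->
  exists zs, [/\ regular_mod (adjoin I x) zs, {subset zs <= J} &
                 size zs = (size ys).-1].
Proof.
have [n] := ubnP (size ys); elim: n I x ys => // n IHn I x.
case=> [|y1 [|y2 ys]]; [by exists [::]|by exists [::]|].
move=> /= sn [y1I [y2I ysI]] yJ xJ xI.
have y1J : y1 \in J by apply: yJ; rewrite !inE eqxx.
have y2J : y2 \in J by apply: yJ; rewrite !inE eqxx orbT.
pose K i := nth I [:: I; adjoin I x; adjoin I y1] i.
have [[z zJ zK]|[i [b [ilt bK JbK]]]] := exists_nzd_mod noA K 3 J; last first.
  exfalso; case: i ilt bK JbK => [|[|[|//]]] _ /negP bK JbK; apply: bK.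
  - exact/xI/JbK.
  - (* If [J] kills [b] modulo [I + x], write [y1 * b] as [c * x] modulo [I];
       then [J] kills [c] modulo [I + y1], so [c] is in [I + y1] by regularity
       of [y2], and this puts [b] in [I + x]. *)
    have /adjoinP[c hc] := JbK y1 y1J.
    have /y2I/adjoinP[d hd] : y2 * c \in adjoin I y1.
      have /adjoinP[d hd] := JbK y2 y2J.
      apply/adjoinP; exists d; apply: xI.
      have -> : x * (y2 * c - d * y1) =
        y1 * (y2 * b - d * x) - y2 * (y1 * b - c * x) by ring.
      by rewrite rpredB ?idealM.
    apply/adjoinP; exists d; apply: y1I.
    have -> : y1 * (b - d * x) = (y1 * b - c * x) + x * (c - d * y1) by ring.
    by rewrite rpredD ?idealM.
  - exact/y2I/JbK.
(* From here on the sequences are, in turn, y1, y2, ys; then y1, z, ws; then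
   z, y1, ws; and finally z, x, us, that is x, z, us. *)
have zI : nzd_mod I z := zK 0%N isT.
have zIx : nzd_mod (adjoin I x) z := zK 1%N isT.
have zIy : nzd_mod (adjoin I y1) z := zK 2%N isT.
have [||ws [wsr wsJ wss]] := IHn (adjoin I y1) z (y2 :: ys) sn _ _ zJ zIy => //.
  by move=> w wys; apply: yJ; rewrite inE wys orbT.
have [|||||us [usr usJ uss]] := IHn (adjoin I z) x (y1 :: ws) => //.
- by rewrite /= wss /=; lia.
- by split; [apply: nzd_mod_swap | rewrite adjoinC].
- by move=> w; rewrite inE => /orP[/eqP->|/wsJ].
- exact: nzd_mod_swap.
exists (z :: us); split; first by split; rewrite // adjoinC.
  by move=> w; rewrite inE => /orP[/eqP->|/usJ].
by rewrite /= uss /= wss.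
Qed.

Lemma exchange_seq (noA : noetherian A) I J xs ys :
  regular_mod I xs -> {subset xs <= J} ->
  regular_mod I ys -> {subset ys <= J} ->
  exists zs, [/\ regular_mod (adjoins I xs) zs, {subset zs <= J} &
                 size zs = (size ys - size xs)%N].
Proof.
elim: xs I ys => [|x xs IHxs] I ys; first by exists ys; rewrite subn0.
move=> [xI xsI] xJ ysI ysJ.
have [|zs [zsr zsJ zss]] := exchange noA ysI ysJ _ xI.
  by apply: xJ; rewrite mem_head.
have [|ws [wsr wsJ wss]] := IHxs (adjoin I x) zs xsI _ zsr zsJ.
  by move=> w wxs; apply: xJ; rewrite inE wxs orbT.
by exists ws; split=> //; rewrite wss zss /=; lia.
Qed.

Definition maximal_in J I xs :=
  [/\ regular_mod I xs, {subset xs <= J} &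
      {in J, forall z, ~ nzd_mod (adjoins I xs) z}].

(** If [ys] were longer, [exchange_seq] would leave a term regular modulo
    [I + xs]. So all maximal regular sequences in [J] have the same length. *)
Lemma size_maximal_in (noA : noetherian A) I J xs ys :
  maximal_in J I xs -> regular_mod I ys -> {subset ys <= J} ->
  (size ys <= size xs)%N.
Proof.
move=> [xsI xsJ xsmax] ysI ysJ.
have [zs [zsr zsJ]] := exchange_seq noA xsI xsJ ysI ysJ.
case: zs zsr zsJ => [_ _ /= /esym /eqP //|z zs] /= [zI _] zJ _.
by case: (xsmax z) => //; apply: zJ; rewrite mem_head.
Qed.

Lemma exists_maximal_in (noA : noetherian A) I J :
  {subset I <= J} -> 1 \notin J -> exists xs, maximal_in J I xs.
Proof.
move=> + J1; elim/(noetherian_ind noA): I => I IH IJ.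
have [[z zJ zI]|h] := pselect (exists2 z, z \in J & nzd_mod I z); last first.
  by exists [::]; split=> // z zJ zI; apply: h; exists z.
have [|||xs [xsr xsJ xsmax]] := IH (adjoin I z).
- exact: sub_adjoin.
- move=> /(_ z (mem_adjoin I z)) zinI; case/negP: J1; apply/IJ/zI.
  by rewrite mulr1.
- exact: adjoin_min.
exists (z :: xs); split=> // w; rewrite inE => /orP[/eqP->//|]; exact: xsJ.
Qed.

End Regular.

(** * Chains of primes *)

Section Chains.
Variable A : comPzRingType.
Implicit Types (I J K P Q M : ideal A) (x y z : A) (xs ys zs : seq A).

(** [n] counts the strict inclusions, so the chain consists of [n.+1] primes. *)
Fixpoint chain n P Q : Prop :=
  prime_ideal P /\
  if n is n'.+1
  then exists P', [/\ {subset P <= P'}, ~ {subset P' <= P} & chain n' P' Q]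
  else P = Q.

Lemma chain_prime n P Q : chain n P Q -> prime_ideal P /\ prime_ideal Q.
Proof.
elim: n P => [|n IHn] P /= [hP]; first by move=> <-.
by case=> P' [_ _ /IHn[]].
Qed.

Lemma chain_sub n P Q : chain n P Q -> {subset P <= Q}.
Proof.
elim: n P => [|n IHn] P /= [hP]; first by move=> <-.
by case=> P' [PP' _ /IHn h] x /PP' /h.
Qed.

Lemma chain_cat m n P Q M : chain m P Q -> chain n Q M -> chain (m + n) P M.
Proof.
elim: m P => [|m IHm] P [hP]; first by move=> ->.
by move=> [P' [PP' P'P h]] hQ; split=> //; exists P'; split=> //; apply: IHm.
Qed.

Lemma chain_step P Q : prime_ideal P -> prime_ideal Q ->
  {subset P <= Q} -> ~ {subset Q <= P} -> chain 1 P Q.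
Proof. by move=> hP hQ PQ QP; split=> //; exists Q; split. Qed.

Lemma prime_chainP n P Q :
  chain n P Q <-> exists p, [/\ prime_chain n p, p 0%N = P & p n = Q].
Proof.
elim: n P => [|n IHn] P /=.
  split=> [[hP PQ]|[p [[hp _] p0 pQ]]]; last first.
    by split; [rewrite -p0; apply: hp | rewrite -p0].
  exists (fun=> P); split=> //; split=> [i _ //|i]; by rewrite ltn0.
split=> [[hP [P' [PP' P'P /IHn[p [[hp sp] p0 pQ]]]]]|].
  exists (fun i => if i is j.+1 then p j else P); split=> //.
  split=> [[|i]//|[|i]] ilt; [exact: hp | | exact: sp].
  by rewrite p0; split=> // e; apply: P'P => x; rewrite e.
move=> [p [[hp sp] p0 pQ]]; rewrite -p0; split; first exact: hp.
have [s01 n01] := sp 0%N isT.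
exists (p 1%N); split=> //.
  by move=> s10; apply: n01 => x; apply/idP/idP; [apply: s01|apply: s10].
apply/IHn; exists (fun i => p i.+1); split=> //.
by split=> i h; [exact: hp i.+1 h|exact: sp i.+1 h].
Qed.

(** A prime containing [x], with [x] a non-zero-divisor modulo [I], is not minimal
    over [I]; so each term of a regular sequence contributes a prime. *)
Lemma chain_below (noA : noetherian A) I P xs :
  prime_ideal P -> regular_mod I xs -> {subset xs <= P} -> {subset I <= P} ->
  exists2 Q : ideal A, {subset I <= Q} & chain (size xs) Q P.
Proof.
move=> hP; elim: xs I => [|x xs IHxs] I; first by exists P.
move=> [xI xsI] xP IP.
have [||Q1 xQ1 cQ1] := IHxs (adjoin I x) xsI.
- by move=> y yxs; apply: xP; rewrite inE yxs orbT.
- by apply: adjoin_min => //; apply: xP; rewrite mem_head.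
have hQ1 : prime_ideal Q1 by case: (chain_prime cQ1).
have [|Q [hQ IQ QQ1 xQ]] := @prime_below _ noA I Q1 x hQ1.
  move=> s k sQ1; apply/negP => sxI; case/negP: sQ1; apply/xQ1/sub_adjoin.
  elim: k sxI => [|k IHk]; first by rewrite mulr1.
  by rewrite exprS mulrCA => /xI.
exists Q => //; apply: (@chain_cat 1) cQ1; apply: chain_step => //.
by move/(_ x (xQ1 _ (mem_adjoin I x))); apply/negP.
Qed.

(** The total quotient ring of [A / I] has dimension zero: in it the powers of any
    [a] generate a stationary sequence of ideals, [a ^+ k = a ^+ k.+1 * (c / t)]. *)
Definition frac_zero_dim I :=
  forall a, exists k t c, nzd_mod I t /\ a ^+ k * (t - a * c) \in I.

(** If [a] is in the second prime of the chain but not in the first, then in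
    [a ^+ k * (t - a * c) \in I] the second factor lies in the first prime, so
    the non-zero-divisor [t] lies in the second one. *)
Lemma regular_of_chain I M k P : {subset I <= P} -> chain k P M ->
  (forall ys, regular_mod I ys -> {subset ys <= M} ->
     frac_zero_dim (adjoins I ys)) ->
  exists ys, [/\ regular_mod I ys, {subset ys <= M} & size ys = k].
Proof.
elim: k I P => [|k IHk] I P IP cP hpi; first by exists [::].
have [hP [P1 [PP1 h cP1]]] := cP; rewrite -/chain in cP1.
move: h => /existsNP[a /not_implyP[aP1 /negP aP]].
have [||j [t [c [tI h]]]] := hpi [::] _ _ a => //.
have tP1 : t \in P1.
  have : t - a * c \in P.
    have /IP := h; rewrite primeM // => /orP[/primeX -/(_ hP)|//].
    by rewrite (negPf aP).
  move/PP1; rewrite rpredBr //; by rewrite mulrC idealM.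
have tM : t \in M := chain_sub cP1 tP1.
have [||ys [ysI ysM yss]] := IHk (adjoin I t) P1 _ cP1.
- by apply: adjoin_min => // x /IP /PP1.
- move=> ys ysI ysM; apply: (hpi (t :: ys)) => //.
  by move=> x; rewrite inE => /orP[/eqP->|/ysM].
exists (t :: ys); split=> //=; last by rewrite yss.
by move=> x; rewrite inE => /orP[/eqP->|/ysM].
Qed.

(** [M] is contained in the Jacobson radical. *)
Definition radical_units M :=
  forall y, y \in M -> forall c, exists v, v * (1 - y * c) = 1.

(** An associated prime [P] of [I] has dimension at least the length of any
    regular sequence in the radical. Choose [z] annihilated by [P] and not
    divisible by the first term [y] modulo [I]; then [P] and [y] annihilate [z]
    modulo [I + y], hence lie in an associated prime of [I + y], which is larger
    than [P] since it contains [y]. *)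
Lemma chain_above (noA : noetherian A) M I b ys :
  radical_units M -> b \notin I -> prime_ideal (colon I b) ->
  regular_mod I ys -> {subset ys <= M} ->
  exists Q, chain (size ys) (colon I b) Q.
Proof.
move=> Mrad; elim: ys I b => [|y ys IHys] I b bI hP.
  by exists (colon I b).
move=> [yI ysI] yM; pose P := colon I b.
have [|z [[zI Pz] _ zmax]] := @noetherian_max A noA A
  (fun z => z \notin I /\ {in P, forall p, p * z \in I}) (adjoin I) b.
  by split=> // p; rewrite colonE.
(* If [z] were [a * y] modulo [I], then [P] would also annihilate [a], and by
   maximality of [I + z] the element [a] would be a multiple of [z]. *)
have zIy : z \notin adjoin I y.
  apply/negP => /adjoinP[a ha]; case/negP: (zI).
  have aI : a \notin I.
    apply: contra zI => aI; rewrite -(subrK (a * y) z) rpredD // mulrC.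
    exact: idealM.
  have /adjoinP[c hc] : a \in adjoin I z.
    apply: (zmax a); last exact: mem_adjoin.
      split=> // p pP; apply: yI.
      have -> : y * (p * a) = p * z - p * (z - a * y) by ring.
      by rewrite rpredB ?Pz ?idealM.
    apply: adjoin_min; first exact: sub_adjoin.
    by apply/adjoinP; exists y; rewrite mulrC.
  have [v hv] := Mrad y (yM y (mem_head _ _)) c.
  have -> : z = v * ((1 - y * c) * z) by rewrite mulrA hv mul1r.
  apply: idealM.
  have -> : (1 - y * c) * z = (z - a * y) + y * (a - c * z) by ring.
  by rewrite rpredD ?idealM.
have [c [czI hQ zcz]] := exists_prime_colon noA zIy.
have [|Q cQ] := IHys (adjoin I y) (c * z) czI hQ ysI.
  by move=> x xys; apply: yM; rewrite inE xys orbT.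
exists Q; apply: (@chain_cat 1) cQ; apply: chain_step => //.
  by move=> p pP; apply: zcz; rewrite colonE; apply/sub_adjoin/Pz.
move=> /(_ y); rewrite !colonE => h; case/negP: bI; apply: yI; apply: h.
by apply/adjoinP; exists (c * z); rewrite mulrC subrr ideal0.
Qed.

(** If all associated primes of [I] are minimal, [(I : a ^+ k) + a] contains a
    non-zero-divisor [t] as soon as the ideals [(I : a ^+ k)] are stationary:
    an associated prime [P] containing that ideal would contain [a], hence some
    [s * a ^+ l] with [s] outside [P] would be in [I], while [s] is in [P]. *)
Lemma unmixed_frac_zero_dim (noA : noetherian A) I :
  (forall b, b \notin I -> prime_ideal (colon I b) ->
     {in colon I b, forall a,
        exists s k, s \notin colon I b /\ s * a ^+ k \in I}) ->
  frac_zero_dim I.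
Proof.
move=> unmix a.
have [//|k [_ _ kmax]] := @noetherian_max A noA nat (fun=> True)
  (fun k => colon I (a ^+ k)) 0%N.
have kstab l : {subset colon I (a ^+ l) <= colon I (a ^+ k)}.
  move=> s sl; apply: (kmax (l + k)%N) => //; rewrite exprD.
    exact: sub_colonM.
  by rewrite mulrC; apply: sub_colonM.
have [[t /adjoinP[c hc] tI]|[_ [b [_ bI bJ]]]] :=
    exists_nzd_mod noA (fun=> I) 1 (adjoin (colon I (a ^+ k)) a).
  exists k, t, c; split; first exact: tI 0%N isT.
  by move: hc; rewrite colonE mulrC (mulrC c).
have [c [cbI hP bcb]] := exists_prime_colon noA bI.
have aP : a \in colon I (c * b).
  by apply: bcb; rewrite colonE; apply/bJ/mem_adjoin.
have [s [l [sP sl]]] := unmix _ cbI hP a aP.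
case/negP: sP; apply: bcb; rewrite colonE; apply/bJ/sub_adjoin/(kstab l).
by rewrite colonE.
Qed.

(** Unmixedness. A prime [Q] containing [I + xs] and properly contained in an
    associated prime of [I + xs] would lie on a chain with [size xs] steps below
    [Q], one step from [Q] to the associated prime, and [d - size xs] steps above
    it, that is more than [d] steps altogether. *)
Lemma cm_frac_zero_dim (noA : noetherian A) M I d ys xs :
  radical_units M -> (forall n P Q, chain n P Q -> (n <= d)%N) ->
  regular_mod I ys -> {subset ys <= M} -> size ys = d ->
  regular_mod I xs -> {subset xs <= M} -> frac_zero_dim (adjoins I xs).
Proof.
move=> Mrad dimA ysI ysM yss xsI xsM.
apply: unmixed_frac_zero_dim => // b bI hP a aP; apply: contrapT => h.
have [|Q [hQ IQ QP aQ]] :=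
    @prime_below _ noA (adjoins I xs) (colon (adjoins I xs) b) a hP.
  by move=> s k sP; apply/negP => sI; apply: h; exists s, k.
have [||Q0 _ cQ0] := chain_below noA hQ xsI.
- by move=> x /(mem_adjoins I) /IQ.
- by move=> x /(sub_adjoins xs) /IQ.
have [zs [zsr zsM zss]] := exchange_seq noA xsI xsM ysI ysM.
have [T cT] := chain_above noA Mrad bI hP zsr zsM.
have cQP : chain 1 Q (colon (adjoins I xs) b).
  by apply: chain_step => //; move/(_ a aP); apply/negP.
have := dimA _ _ _ (chain_cat (chain_cat cQ0 cQP) cT).
by rewrite zss yss; lia.
Qed.

End Chains.

(** * Quotient modules and tensors *)

(** Packaging the closure properties with the predicate lets one and the same
    construction serve for [A / I] and for the module [B[1/b]] below. *)
Record submodule (A : pzRingType) (V : lmodType A) := Submodule {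
  submod_pred :> {pred V};
  submod_subproof : submod_closed submod_pred
}.

HB.instance Definition _ (A : pzRingType) (V : lmodType A) (W : submodule V) :=
  GRing.isSubmodClosed.Build A V (submod_pred W) (submod_subproof W).

Section QuotientModule.
Variables (A : pzRingType) (V : lmodType A) (W : submodule V).

Definition quot_mod : Type := Quotient.quot (submod_pred W).
HB.instance Definition _ := GRing.Zmodule.on quot_mod.
HB.instance Definition _ := EqQuotient.on quot_mod.

Definition qmk (v : V) : quot_mod := \pi_quot_mod v.

Lemma qmkE u v : (qmk u == qmk v) = (u - v \in W).
Proof. by rewrite /qmk -(Quotient.idealrBE (submod_pred W)). Qed.

Lemma qmkP u v : reflect (qmk u = qmk v) (u - v \in W).
Proof. by rewrite -qmkE; apply: eqP. Qed.

Lemma qmkD u v : qmk (u + v) = qmk u + qmk v.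
Proof. by rewrite /qmk !piE. Qed.

Lemma qmk_reprK x : qmk (repr x) = x.
Proof. by rewrite /qmk reprK. Qed.

Lemma repr_qmk v : repr (qmk v) - v \in W.
Proof. by apply/qmkP; rewrite qmk_reprK. Qed.

Definition qscale (a : A) (x : quot_mod) : quot_mod := qmk (a *: repr x).

Lemma qmkZ a v : qmk (a *: v) = qscale a (qmk v).
Proof. by apply/esym/qmkP; rewrite -scalerBr rpredZ ?repr_qmk. Qed.

Fact qscaleA a b x : qscale a (qscale b x) = qscale (a * b) x.
Proof. by rewrite -[x]qmk_reprK -!qmkZ scalerA. Qed.

Fact qscale1 : left_id 1 qscale.
Proof. by move=> x; rewrite -[x]qmk_reprK -qmkZ scale1r. Qed.

Fact qscaleDr : right_distributive qscale +%R.
Proof.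
move=> a x y; rewrite -[x]qmk_reprK -[y]qmk_reprK.
by rewrite -qmkD -!qmkZ -qmkD scalerDr.
Qed.

Fact qscaleDl x : {morph qscale^~ x : a b / a + b}.
Proof. by move=> a b; rewrite -[x]qmk_reprK -!qmkZ scalerDl qmkD. Qed.

HB.instance Definition _ := GRing.Zmodule_isLmodule.Build A quot_mod
  qscaleA qscale1 qscaleDr qscaleDl.

Lemma qmk_scale a v : qmk (a *: v) = a *: qmk v.
Proof. exact: qmkZ. Qed.

Lemma qmk_linear : linear qmk.
Proof. by move=> a u v; rewrite qmkD qmkZ. Qed.

HB.instance Definition _ := GRing.isLinear.Build A V quot_mod *:%R qmk qmk_linear.

End QuotientModule.

(** * Perfect rings are strongly pi-regular *)

(** The localization [A[1/a]] is realized as the module of sequences [f] with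
    [f j.+1 = a * f j] for large [j], modulo the sequences that vanish for large
    [j]: the fraction [x / a ^+ k] is represented by [j |-> x * a ^+ (j - k)].
    In this form both flatness and the use of projectivity are direct: tensors
    are evaluated termwise, and a section of the projection from sequences is
    examined at a single term. *)

Section InvertElement.
Variables (A : comPzRingType) (a : A).

Definition geometric : {pred nat -> A^o} :=
  [pred f | `[< exists k, forall j, (k <= j)%N -> f j.+1 = a * f j >]].

Lemma geometric_closed : submod_closed geometric.
Proof.
split=> [|b f g].
  by rewrite inE; apply/asboolP; exists 0%N => j _; rewrite mulr0.
rewrite !inE => /asboolP[k hf] /asboolP[l hg]; apply/asboolP.
exists (maxn k l) => j; rewrite geq_max => /andP[kj lj].
by rewrite !fctE hf // hg // /GRing.scale /=; ring.
Qed.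

Record geoseq := Geoseq { geoval :> nat -> A^o; _ : geoval \in geometric }.
HB.instance Definition _ := [isSub for geoval].
HB.instance Definition _ := [Choice of geoseq by <:].
HB.instance Definition _ :=
  GRing.SubChoice_isSubLmodule.Build A (nat -> A^o) geometric geoseq
    geometric_closed.

Definition evzero : {pred geoseq} :=
  [pred f | `[< exists k, forall j, (k <= j)%N -> geoval f j = 0 >]].

Lemma evzero_closed : submod_closed evzero.
Proof.
split=> [|b f g].
  by rewrite inE; apply/asboolP; exists 0%N => j _.
rewrite !inE => /asboolP[k hf] /asboolP[l hg]; apply/asboolP.
exists (maxn k l) => j; rewrite geq_max => /andP[kj lj].
have -> : geoval (b *: f + g) j = b * geoval f j + geoval g j by [].
by rewrite hf // hg // mulr0 addr0.
Qed.

Definition inv_module := quot_mod (Submodule evzero_closed).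
HB.instance Definition _ := GRing.Lmodule.on inv_module.

Definition bcls (f : geoseq) : inv_module := qmk _ f.
Definition brep (x : inv_module) : geoseq := repr x.

Lemma bclsP f g : bcls f = bcls g <->
  exists k, forall j, (k <= j)%N -> f j = g j.
Proof.
split=> [/qmkP|[k hk]].
  rewrite inE => /asboolP[k hk]; exists k => j /hk.
  by move=> h; apply/subr0_eq.
apply/qmkP; rewrite inE; apply/asboolP; exists k => j kj.
by apply/eqP; rewrite -[_ j]/(f j - g j) hk // subrr.
Qed.

Lemma brepK x : bcls (brep x) = x.
Proof. exact: qmk_reprK. Qed.

Lemma bclsZ c f : bcls (c *: f) = c *: bcls f.
Proof. exact: qmkZ. Qed.

Lemma bclsD f g : bcls (f + g) = bcls f + bcls g.
Proof. exact: qmkD. Qed.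

Lemma brepD x y : exists k, forall j, (k <= j)%N ->
  brep (x + y) j = brep x j + brep y j.
Proof.
have /bclsP[k hk] : bcls (brep (x + y)) = bcls (brep x + brep y).
  by rewrite bclsD !brepK.
by exists k => j /hk.
Qed.

Lemma brepZ c x : exists k, forall j, (k <= j)%N ->
  brep (c *: x) j = c * brep x j.
Proof.
have /bclsP[k hk] : bcls (brep (c *: x)) = bcls (c *: brep x).
  by rewrite bclsZ !brepK.
by exists k => j /hk.
Qed.

Lemma brep0 : exists k, forall j, (k <= j)%N -> brep 0 j = 0.
Proof.
have /bclsP[k hk] : bcls (brep 0) = bcls 0.
  by rewrite brepK; apply/esym/(linear0 (qmk _)).
by exists k => j /hk.
Qed.

(** The sequence representing [1 / a ^+ k]; truncated subtraction makes its terms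
    of index below [k] equal to 1, which the passage to the quotient ignores. *)
Fact power_geometric k : (fun j => a ^+ (j - k)) \in geometric.
Proof.
by rewrite inE; apply/asboolP; exists k => j kj; rewrite subSn // exprS.
Qed.
Definition power k : geoseq := Geoseq (power_geometric k).

Lemma inv_module_power x : exists k, forall j, (k <= j)%N ->
  x = brep x j *: bcls (power j).
Proof.
have := valP (brep x); rewrite inE => /asboolP[k hk].
exists k => j kj; rewrite -[LHS]brepK.
rewrite -bclsZ; apply/bclsP; exists j => l jl.
rewrite -[RHS]/(brep x j * a ^+ (l - j)) -(subnKC jl) /=.
elim: (l - j)%N => [|m IHm]; first by rewrite addn0 subnn mulr1.
rewrite addnS; have /hk : (k <= j + m)%N by rewrite (leq_trans kj) ?leq_addr.
by rewrite /= -[geoval _]/(geoval _) IHm subSn ?leq_addr // exprS mulrCA.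
Qed.

Section Tensor.
Variable N : lmodType A.
Implicit Types (s t : seq (inv_module * N)).

Definition tensor_value s j : N := \sum_(p <- s) brep p.1 j *: p.2.

(** The terms of large index of the values of a tensor are an invariant, since
    representatives are additive and linear up to finitely many terms. *)
Lemma tensor_value_eq s t : tensor_eq s t ->
  exists k, forall j, (k <= j)%N -> tensor_value s j = tensor_value t j.
Proof.
elim=> {s t}.
- by move=> s; exists 0%N.
- by move=> s t _ [k hk]; exists k => j /hk.
- move=> s t u _ [k hk] _ [l hl]; exists (maxn k l) => j.
  by rewrite geq_max => /andP[/hk-> /hl->].
- move=> s t s' t' _ [k hk] _ [l hl]; exists (maxn k l) => j.
  rewrite geq_max /tensor_value !big_cat => /andP[/hk + /hl].
  by rewrite /tensor_value => -> ->.
- by move=> s t; exists 0%N => j _; rewrite /tensor_value !big_cat /= addrC.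
- have [k hk] := brep0; move=> n; exists k => j /hk h.
  by rewrite /tensor_value big_nil big_seq1 h scale0r.
- move=> m m' n; have [k hk] := brepD m m'; exists k => j /hk h.
  by rewrite /tensor_value !big_cons !big_nil /= !addr0 h scalerDl.
- move=> m n n'; exists 0%N => j _.
  by rewrite /tensor_value !big_cons !big_nil /= !addr0 scalerDr.
- move=> c m n; have [k hk] := brepZ c m; exists k => j /hk h.
  by rewrite /tensor_value !big_seq1 h scalerA mulrC.
Qed.

(** Conversely these terms determine the tensor, which can be brought to the
    common denominator [a ^+ j]. *)
Lemma tensor_normal s : exists k, forall j, (k <= j)%N ->
  tensor_eq s [:: (bcls (power j), tensor_value s j)].
Proof.
elim: s => [|[x n] s [k hk]].
  exists 0%N => j _; rewrite /tensor_value big_nil; apply: tensor_sym.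
  apply: tensor_trans (tensor_0l _ 0); rewrite -[X in (_, X)](scale0r 0).
  apply: tensor_trans (tensor_sym (tensor_Z _ _ _)) _.
  by rewrite scale0r; apply: tensor_refl.
have [l hl] := inv_module_power x; exists (maxn k l) => j.
rewrite geq_max => /andP[kj lj].
rewrite /tensor_value big_cons -/(tensor_value s j) /=.
apply: tensor_trans (tensor_sym (tensor_Dr _ _ _)).
rewrite -cat1s -[X in tensor_eq _ X]cat1s; apply: tensor_cat (hk j kj).
by rewrite {1}(hl j lj); apply: tensor_Z.
Qed.

End Tensor.

Lemma flat_inv_module : flat inv_module.
Proof.
move=> N N' f finj s t /tensor_value_eq[k hk].
have tensor_value_map u j :
    tensor_value (tensor_map f u) j = f (tensor_value u j).
  rewrite /tensor_value big_map linear_sum.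
  by apply: eq_bigr => p _; rewrite linearZ.
have [l hl] := tensor_normal s; have [m hm] := tensor_normal t.
pose j := maxn k (maxn l m).
apply: tensor_trans (hl j _) _; first by rewrite /j; lia.
have -> : tensor_value s j = tensor_value t j.
  by apply: finj; rewrite -!tensor_value_map hk // /j; lia.
by apply/tensor_sym/hm; rewrite /j; lia.
Qed.

(** A section [h] of the projection maps [1 = a ^+ i * (1 / a ^+ i)] to a sequence
    divisible by [a ^+ i] for all [i], whose term of index [k] is [a ^+ k] when
    [k] is large. Taking [i = k.+1] gives the relation. *)
Lemma perfect_pi_regular : perfect A -> exists k c, a ^+ k = a ^+ k.+1 * c.
Proof.
move=> /(_ inv_module flat_inv_module) /(_ geoseq inv_module).
move=> /(_ (qmk (Submodule evzero_closed)) idfun).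
case=> [x|h hK]; first by exists (brep x); apply: qmk_reprK.
have hpow i : geoval (h (bcls (power 0))) = a ^+ i *: geoval (h (bcls (power i))).
  have -> : bcls (power 0) = a ^+ i *: bcls (power i).
    rewrite -bclsZ; apply/bclsP; exists i => j ij /=.
    by rewrite -[RHS]/(a ^+ i * a ^+ (j - i)) -exprD subnKC // subn0.
  by rewrite linearZ.
have /bclsP[k /(_ k (leqnn k))] := hK (bcls (power 0)).
rewrite (hpow k.+1) /= subn0 => e.
by exists k, (geoval (h (bcls (power k.+1))) k); rewrite -e.
Qed.

End InvertElement.

Section LinearFun.
Variables (A : pzRingType) (U V : lmodType A).

Definition lin_fun (f : U -> V) of linear f := f.

HB.instance Definition _ (f : U -> V) (fl : linear f) :=
  GRing.isLinear.Build A U V *:%R (lin_fun fl) fl.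
End LinearFun.

(** * Submodules [I M] of flat modules *)

Section IdealTimesModule.
Variables (A : comPzRingType) (M : lmodType A).
Implicit Types (I J : ideal A) (x y : M).

Definition lcomb (s : seq (A * M)) : M := \sum_(p <- s) p.1 *: p.2.

(** [x] belongs to the submodule [I M]. *)
Definition idmod I x := exists2 s, all (fun p => p.1 \in I) s & x = lcomb s.

Lemma lcomb_cat s t : lcomb (s ++ t) = lcomb s + lcomb t.
Proof. by rewrite /lcomb big_cat. Qed.

Definition lscale a (s : seq (A * M)) := [seq (a * p.1, p.2) | p <- s].

Lemma lcomb_scale a s : lcomb (lscale a s) = a *: lcomb s.
Proof.
rewrite /lcomb big_map scaler_sumr.
by apply: eq_bigr => p _; rewrite scalerA.
Qed.

Lemma idmod0 I : idmod I 0.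
Proof. by exists [::] => //; rewrite /lcomb big_nil. Qed.

Lemma idmod_mem I a x : a \in I -> idmod I (a *: x).
Proof. by move=> aI; exists [:: (a, x)]; rewrite /= ?aI // /lcomb big_seq1. Qed.

Lemma idmodD I x y : idmod I x -> idmod I y -> idmod I (x + y).
Proof.
move=> [s hs ->] [t ht ->]; exists (s ++ t); last by rewrite lcomb_cat.
by rewrite all_cat hs ht.
Qed.

Lemma idmodZ I a x : idmod I x -> idmod I (a *: x).
Proof.
move=> [s hs ->]; exists (lscale a s); last by rewrite lcomb_scale.
by rewrite all_map; apply: sub_all hs => p /= pI; apply: idealM.
Qed.

Lemma idmodB I x y : idmod I x -> idmod I y -> idmod I (x - y).
Proof. by move=> hx hy; rewrite -scaleN1r; apply/idmodD/idmodZ. Qed.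

Lemma idmod_sub I J x : {subset I <= J} -> idmod I x -> idmod J x.
Proof. by move=> IJ [s hs ->]; exists s => //; apply: sub_all hs => p /IJ. Qed.

Definition ideal_submod I : submodule (A^o : lmodType A) :=
  @Submodule A A^o (ideal_pred I) (ideal_subproof I).

(** The isomorphism of [M (x) A/I] with [M / I M], in the direction in which it
    detects tensors *)
Lemma tensor_quot_eq I (s t : seq (M * quot_mod (ideal_submod I))) :
  tensor_eq s t ->
  idmod I (\sum_(p <- s) (repr p.2 : A) *: p.1 -
           \sum_(p <- t) (repr p.2 : A) *: p.1).
Proof.
have step (a b : A) x : a - b \in I -> idmod I (a *: x - b *: x).
  by move=> h; rewrite -scalerBl; apply: idmod_mem.
elim=> {s t}.
- by move=> s; rewrite subrr; apply: idmod0.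
- by move=> s t _ h; rewrite -opprB -scaleN1r; apply: idmodZ.
- move=> s t u _ h _ k.
  rewrite -(subrK (\sum_(p <- t) (repr p.2 : A) *: p.1) (\sum_(p <- s) _)).
  by rewrite -addrA; apply: idmodD.
- by move=> s t s' t' _ h _ k; rewrite !big_cat /= opprD addrACA; apply: idmodD.
- by move=> s t; rewrite !big_cat /= addrC subrr; apply: idmod0.
- by move=> n; rewrite big_nil big_seq1 scaler0 subr0; apply: idmod0.
- move=> m m' n; rewrite !big_cons !big_nil /= !addr0 scalerDr subrr.
  exact: idmod0.
- move=> m n n'; rewrite !big_cons !big_nil /= !addr0 -scalerDl; apply: step.
  by apply/(qmkP (ideal_submod I)); rewrite qmkD !qmk_reprK.
- move=> a m n; rewrite !big_seq1 /= scalerA; apply: step; rewrite mulrC.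
  rewrite -opprB rpredN; apply/(qmkP (ideal_submod I)).
  by rewrite -[a * _]/(a *: (_ : A^o)) qmkZ !qmk_reprK.
Qed.

(** Flatness turns the injection of [A / (J : c)] into [A / J], multiplication by
    [c], into the identity [(J M : c) = (J : c) M]. The rest of the argument
    for sufficiency uses flatness through this identity. *)
Lemma flat_colon J c x : flat M -> idmod J (c *: x) -> idmod (colon J c) x.
Proof.
move=> Mflat [s hs e].
pose N := quot_mod (ideal_submod (colon J c)).
pose N' := quot_mod (ideal_submod J).
pose f (y : N) : N' := qmk _ ((c * repr y : A) : A^o).
have fE (y : A^o) : f (qmk _ y) = qmk _ ((c * y : A) : A^o).
  apply/qmkP; rewrite -mulrBr mulrC.
  exact: (repr_qmk (ideal_submod (colon J c))).
have flin : linear f.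
  move=> a y z; rewrite -[y]qmk_reprK -[z]qmk_reprK -linearP !fE -linearP.
  by congr qmk; rewrite mulrDr mulrCA.
have finj : injective (lin_fun flin).
  move=> y z; rewrite -[y]qmk_reprK -[z]qmk_reprK /lin_fun !fE => /qmkP h.
  by apply/qmkP; rewrite -mulrBr mulrC in h; exact: h.
have h0 : tensor_eq (tensor_map (lin_fun flin)
    [:: (x, qmk _ (1 : A^o) : N)]) (tensor_map (lin_fun flin) [::]).
  rewrite /tensor_map /= /lin_fun fE mulr1 -[c in qmk _ c]mulr1.
  rewrite -[c * 1]/(c *: (1 : A^o)) qmkZ.
  apply: tensor_trans (tensor_sym (tensor_Z _ _ _)) _; rewrite e.
  elim: s hs {e} => [|p s IHs] /=.
    by move=> _; rewrite /lcomb big_nil; apply: tensor_0l.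
  case/andP=> pJ sJ; rewrite /lcomb big_cons -/(lcomb s).
  apply: tensor_trans (tensor_Dl _ _ _) _; rewrite -cat1s -[[::]]cats0.
  apply: tensor_cat (IHs sJ); apply: tensor_trans (tensor_Z _ _ _) _.
  rewrite -qmk_scale.
  have -> : qmk (ideal_submod J) (p.1 *: (1 : A^o)) = 0 *: 0.
    rewrite scale0r -(linear0 (qmk (ideal_submod J))); apply/qmkP.
    by rewrite subr0 -[_ *: _]/(p.1 * 1) mulr1.
  apply: tensor_trans (tensor_sym (tensor_Z _ _ _)) _.
  by rewrite scale0r; apply: tensor_0l.
have := tensor_quot_eq (Mflat _ _ _ finj _ _ h0).
rewrite big_nil big_seq1 subr0 /= => h.
rewrite -[x]scale1r.
rewrite -(subrK (repr (qmk (ideal_submod (colon J c)) 1) *: x) (1 *: x)).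
apply: idmodD h; rewrite -scalerBl; apply: idmod_mem; rewrite -opprB rpredN.
exact: (repr_qmk (ideal_submod (colon J c))).
Qed.

End IdealTimesModule.

(** * Flat modules over a local factor of the ring *)

(** The idempotent [e] cuts out a factor [e A] that is local with nil maximal
    ideal; [Q] is the inverse image of that ideal in [A]. Modules over the factor
    are not formed: statements about [M] are multiplied by [e] instead. *)

Section LocalFactor.
Variables (A : comPzRingType) (noA : noetherian A) (e : A) (Q : ideal A).
Hypothesis eid : e * e = e.
Hypothesis hQ : prime_ideal Q.
Hypothesis eQ : e \notin Q.
Hypothesis Qunit : forall a, a \notin Q -> exists v, v * a * e = e.
Hypothesis Qnil : forall a, a \in Q -> exists k, a ^+ k * e = 0.
Variable M : lmodType A.

Lemma notin_unit a : a \notin Q -> exists v, 1 - v * a \in Q.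
Proof.
move=> /Qunit[v hv]; exists v.
have : e * (1 - v * a) \in Q by rewrite mulrBr mulr1 mulrC hv subrr ideal0.
by rewrite primeM // (negPf eQ).
Qed.

Definition indep n (b : nat -> M) := forall c : nat -> A,
  idmod Q (\sum_(i < n) c i *: b i) -> forall i, (i < n)%N -> c i \in Q.

(** Flatness lifts linear independence from the residue field. A relation puts
    [b 0] in [(J : c 0) M], where [J] is generated by the other coefficients. As
    [b 0] is nonzero modulo [Q M], the ideal [(J : c 0)] contains a unit of the
    factor, so [e * c 0] is a combination of the other coefficients. Substituting
    it gives a shorter relation, between vectors that are still independent. *)
Lemma flat_indep n (b : nat -> M) (c : nat -> A) : flat M -> indep n b ->
  \sum_(i < n) c i *: b i = 0 -> forall i, (i < n)%N -> e * c i = 0.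
Proof.
move=> Mflat; elim: n b c => // n IHn b c bind.
rewrite big_ord_recl /= => rel.
pose J := gen (mkseq (fun i => c i.+1) n).
have cJ i : (i < n)%N -> c i.+1 \in J.
  move=> ilt; apply: mem_gen; apply/mapP; exists i => //.
  by rewrite mem_iota.
have b0 : idmod (colon J (c 0%N)) (b 0%N).
  apply: flat_colon => //; move/eqP: rel; rewrite addr_eq0 => /eqP->.
  rewrite -scaleN1r; apply: idmodZ.
  exists [seq (c (lift ord0 i), b (lift ord0 i)) | i <- enum 'I_n].
    by apply/allP => p /mapP[i _ ->] /=; apply: cJ.
  by rewrite /lcomb big_map big_enum.
have [a aJ aQ] : exists2 a, a \in colon J (c 0%N) & a \notin Q.
  apply: contrapT => h; have JQ : {subset colon J (c 0%N) <= Q}.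
    by move=> a aJ; apply: contrapT => /negP aQ; apply: h; exists a.
  have : (fun i => (i == 0%N)%:R) 0%N \in Q.
    apply: (bind (fun i => (i == 0%N)%:R)) => //.
    rewrite big_ord_recl /= scale1r big1 ?addr0; first exact: idmod_sub JQ b0.
    by move=> i _; rewrite scale0r.
  by case: hQ => /negPf->.
have [v hv] := Qunit aQ.
have [d hd] : exists d : nat -> A, e * c 0%N = \sum_(i < n) c i.+1 * (e * d i).
  have /mem_genP[d] : v * (a * c 0%N) \in J by apply: idealM; rewrite -colonE.
  rewrite size_mkseq => hd; exists d; rewrite -[in LHS]hv.
  transitivity (e * (v * (a * c 0%N))); first by ring.
  rewrite hd mulr_sumr; apply: eq_bigr => i _; rewrite nth_mkseq //; ring.
pose b' i := (e * d i) *: b 0%N + e *: b i.+1.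
have b'E (c' : nat -> A) : \sum_(i < n) c' i *: b' i =
    (\sum_(i < n) c' i * (e * d i)) *: b 0%N + \sum_(i < n) (c' i * e) *: b i.+1.
  rewrite scaler_suml -big_split; apply: eq_bigr => i _.
  by rewrite scalerDr !scalerA.
have cS i : (i < n)%N -> e * c i.+1 = 0.
  apply: (IHn b' (fun i => c i.+1)).
    move=> c' h j jlt.
    pose cc l := if l is k.+1 then c' k * e else \sum_(i < n) c' i * (e * d i).
    have : cc j.+1 \in Q by apply: bind => //; rewrite big_ord_recl /= -b'E.
    by rewrite /= primeM // (negPf eQ) orbF.
  rewrite (b'E (fun i => c i.+1)) -hd -scalerA.
  rewrite -[RHS](scaler0 _ e) -[in RHS]rel.
  rewrite scalerDr scaler_sumr; congr (_ + _); apply: eq_bigr => j _.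
  by rewrite scalerA mulrC.
case=> [_|i]; last by rewrite ltnS; apply: cS.
rewrite -eid -mulrA hd mulr_sumr big1 // => i _.
by rewrite mulrA cS // mul0r.
Qed.

Definition span_mod (B : set M) x := exists s : seq (A * M),
  (forall p, p \in s -> B p.2) /\ idmod Q (x - lcomb s).

Definition span (B : set M) x := exists s : seq (A * M),
  (forall p, p \in s -> B p.2) /\ x = lcomb s.

Definition without (B : set M) b : set M := fun y => B y /\ y <> b.

(** Independence modulo [Q M], in the form to which maximality applies directly *)
Definition qfree (B : set M) := forall b, B b -> ~ span_mod (without B b) b.

Lemma span_mod_mem (B : set M) x : B x -> span_mod B x.
Proof.
move=> Bx; exists [:: (1, x)]; split; first by move=> p; rewrite inE => /eqP->.
by rewrite /lcomb big_seq1 scale1r subrr; apply: idmod0.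
Qed.

Lemma lcomb_filter (P : pred (A * M)) s :
  lcomb s = lcomb (filter P s) + lcomb (filter (predC P) s).
Proof. by rewrite /lcomb !big_filter (bigID P). Qed.

Lemma qfree_bigcup (F : set (set M)) : (forall B, F B -> qfree B) ->
  total_on F classical_sets.subset -> qfree (\bigcup_(B in F) B)%classic.
Proof.
move=> Ffree Ftot b [B0 FB0 B0b] [s [sB h]].
have [B [FB B0B sB']] : exists B, [/\ F B, (B0 `<=` B)%classic &
    forall p, p \in s -> without B b p.2].
  elim: s sB {h} => [|p s IHs] sB; first by exists B0; split=> // y.
  have [|B [FB B0B hB]] := IHs.
    by move=> q qs; apply: sB; rewrite inE qs orbT.
  have [[B1 FB1 B1p] pb] := sB p (mem_head _ _).
  have [B1B|BB1] := Ftot _ _ FB1 FB.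
    exists B; split=> // q; rewrite inE => /orP[/eqP->|/hB//].
    by split=> //; apply: B1B.
  exists B1; split=> //; first by move=> y /B0B /BB1.
  move=> q; rewrite inE => /orP[/eqP->//|/hB[Bq qb]]; split=> //; exact: BB1.
by apply: (Ffree B FB b (B0B _ B0b)); exists s.
Qed.

(** A lift to [M] of a basis of the residue vector space, by maximality: if [x] is
    outside a maximal [B], then [x] itself, or some [b] in [B] with an invertible
    coefficient at [x], depends on the others. *)
Lemma exists_qbasis : exists2 B : set M, qfree B & forall x, span_mod B x.
Proof.
have [B [Bfree Bmax]] := @Zorn_bigcup M qfree qfree_bigcup.
exists B => // x; have [Bx|nBx] := pselect (B x); first exact: span_mod_mem.
pose B' : set M := fun y => B y \/ y = x.
have /existsNP[b /not_implyP[B'b /contrapT[s [sB h]]]] : ~ qfree B'.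
  apply: Bmax; split; first by move=> y; left.
  by move=> /(_ x) sub; apply: nBx; apply: sub; right.
have [bx|bx] := pselect (b = x).
  subst b; exists s; split=> // p /sB[[]] //.
have {B'b} Bb : B b by case: B'b.
pose P (p : A * M) := p.2 == x.
pose a := \sum_(p <- filter P s) p.1.
pose s' := filter (predC P) s.
have s'B p : p \in s' -> without B b p.2.
  by rewrite mem_filter /= /P => /andP[/eqP px /sB[[|//] Bp pb]]; split.
have {}h : idmod Q (b - a *: x - lcomb s').
  move: h; rewrite (lcomb_filter P s) opprD addrA.
  suff -> : lcomb (filter P s) = a *: x by [].
  rewrite /a scaler_suml /lcomb !big_filter.
  by apply: eq_bigr => p /eqP->.
have [aQ|/notin_unit[v hv]] := boolP (a \in Q).
  case: (Bfree b Bb); exists s'; split=> //.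
  rewrite -(subrK (a *: x) b) addrAC; apply: idmodD => //; exact: idmod_mem.
exists ((v, b) :: lscale (- v) s'); split.
  move=> p; rewrite inE => /orP[/eqP->//|/mapP[q /s'B[qB _] ->]//].
rewrite /lcomb big_cons -/(lcomb _) lcomb_scale /=.
have -> : x - (v *: b + - v *: lcomb s') =
    (1 - v * a) *: x - v *: (b - a *: x - lcomb s').
  rewrite scalerBl scale1r -scalerA !scalerBr scaleNr !opprB.
  by rewrite [X in _ = _ + X]addrCA [RHS]addrA subrK.
by apply: idmodB; [apply: idmod_mem | apply: idmodZ].
Qed.

Lemma spanD B x y : span B x -> span B y -> span B (x + y).
Proof.
move=> [s [sB ->]] [t [tB ->]]; exists (s ++ t); split; last by rewrite lcomb_cat.
by move=> p; rewrite mem_cat => /orP[/sB|/tB].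
Qed.

Lemma spanZ B a x : span B x -> span B (a *: x).
Proof.
move=> [s [sB ->]]; exists (lscale a s); split; last by rewrite lcomb_scale.
by move=> p /mapP[q /sB qB ->].
Qed.

Lemma span0 B : span B 0.
Proof. by exists [::]; split=> //; rewrite /lcomb big_nil. Qed.

(** The ideal of all [a] such that [e * a] maps [M] into the span of [B] is the
    whole ring. Otherwise some [c] outside it has a prime annihilator modulo it;
    this prime contains the nil ideal [Q], so [c * Q] maps [M] into the span, and
    so does [c], because [M] is the span plus [Q M]. This is the nilpotent
    Nakayama lemma without powers of [Q]. *)
Lemma span_of_span_mod (B : set M) :
  (forall x, span_mod B x) -> forall x, span B (e *: x).
Proof.
move=> Bspan.
pose r := [pred a | `[< forall x, span B (e *: (a *: x)) >]].
have hr : 0 \in r /\ forall a, {in r &, forall x y, a * x + y \in r}.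
  split=> [|a b c]; rewrite !inE.
    by apply/asboolP => x; rewrite scale0r scaler0; apply: span0.
  move=> /asboolP hb /asboolP hc; apply/asboolP => x.
  rewrite scalerDl scalerDr; apply: spanD; last exact: hc.
  by rewrite -!scalerA scalerA (mulrC e) -scalerA; apply: spanZ.
pose rI := Ideal hr.
have [|r1] := boolP (1 \in rI).
  by rewrite inE => /asboolP h x; have := h x; rewrite scale1r.
have [c [cr hP _]] := exists_prime_colon noA r1.
rewrite mulr1 in cr hP.
have eP : e \notin colon rI c.
  apply: contra cr; rewrite colonE !inE => /asboolP h; apply/asboolP => x.
  by have := h x; rewrite !scalerA mulrA eid.
have QP : {subset Q <= colon rI c}.
  move=> q /Qnil[k hk]; have : q ^+ k * e \in colon rI c by rewrite hk ideal0.
  by rewrite primeM // (negPf eP) orbF; apply: primeX.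
case/negP: cr; rewrite inE; apply/asboolP => x.
have [s [sB [t tQ h]]] := Bspan x.
rewrite -(subrK (lcomb s) x) h !scalerDr; apply: spanD; last first.
  by do 2!apply: spanZ; exists s.
elim: t tQ {h} => [|p t IHt] /=.
  by rewrite /lcomb big_nil !scaler0 => _; apply: span0.
move=> /andP[/QP pP /IHt ht]; rewrite /lcomb big_cons -/(lcomb _) !scalerDr.
apply: spanD => //; move: pP; rewrite colonE inE => /asboolP /(_ p.2).
by rewrite !scalerA mulrAC mulrA.
Qed.

(** Combinations may repeat a vector, whereas independence concerns distinct
    vectors; so coefficients of equal vectors are added up. *)
Lemma lcomb_group (V : lmodType A) (g : M -> V) (s : seq (A * M)) :
  \sum_(p <- s) p.1 *: g p.2 =
  \sum_(b <- undup (map snd s)) (\sum_(p <- s | p.2 == b) p.1) *: g b.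
Proof.
under [RHS]eq_bigr => b _ do rewrite scaler_suml.
rewrite (exchange_big_dep predT) //= big_seq [RHS]big_seq.
apply: eq_bigr => p ps.
rewrite (eq_bigl (pred1 p.2)); last by move=> b; rewrite /= eq_sym.
rewrite -big_filter filter_pred1_uniq ?undup_uniq ?big_seq1 //.
by rewrite mem_undup map_f.
Qed.

Lemma qfree_relation (B : set M) (V : lmodType A) (g : M -> V) s :
  flat M -> qfree B -> (forall p, p \in s -> B p.2) -> lcomb s = 0 ->
  e *: (\sum_(p <- s) p.1 *: g p.2) = 0.
Proof.
move=> Mflat Bfree sB; rewrite /lcomb (lcomb_group id) lcomb_group.
set l := undup _; set c := fun b => \sum_(p <- s | p.2 == b) p.1.
have lB b : b \in l -> B b by rewrite mem_undup => /mapP[p /sB pB ->].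
rewrite (big_nth 0) big_mkord => rel.
have lind : indep (size l) (nth 0 l).
  move=> d h i il; apply: contrapT => /negP/notin_unit[v hv].
  apply: (Bfree (nth 0 l i)); first by apply/lB/mem_nth.
  exists [seq (- v * d j, nth 0 l j) |
            j : 'I_(size l) <- enum 'I_(size l) & j != i :> nat].
  split.
    move=> p /mapP[j]; rewrite mem_filter => /andP[ji _] -> /=.
    split; first by apply/lB/mem_nth.
    by move/eqP; rewrite nth_uniq ?undup_uniq // (negPf ji).
  rewrite /lcomb big_map big_filter big_enum_cond /=.
  have -> :
     nth 0 l i - \sum_(j < size l | j != i :> nat) (- v * d j) *: nth 0 l j =
     (1 - v * d i) *: nth 0 l i + v *: \sum_(j < size l) d j *: nth 0 l j.
    rewrite [in RHS](bigD1 (Ordinal il)) //= scalerDr scalerBl scale1r scalerA.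
    rewrite addrA subrK.
    congr (_ + _); rewrite -sumrN scaler_sumr; apply: eq_bigr => j _.
    by rewrite mulNr scaleNr opprK scalerA.
  by apply: idmodD; [apply: idmod_mem | apply: idmodZ].
rewrite (big_nth 0) big_mkord scaler_sumr big1 // => i _.
rewrite scalerA (flat_indep (c := fun i => c (nth 0 l i)) Mflat lind rel) //.
by rewrite scale0r.
Qed.

(** The part [e M] is free on a lift [B] of a residue basis, so maps from it lift
    through surjections. The lift is defined on [x] by any expression of [e *: x]
    in [B]; the factor [e] in front of the combination makes it well defined. *)
Lemma lift_local (N N' : lmodType A) (g : {linear N -> N'})
    (f : {linear M -> N'}) :
  flat M -> (forall y, exists x, g x = y) ->
  exists h : {linear M -> N}, forall m, g (h m) = e *: f m.
Proof.
move=> Mflat gsurj.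
have [B Bfree /span_of_span_mod Bspan] := exists_qbasis.
have [S hS] := choice Bspan.
have [n hn] := choice (fun b => gsurj (f b)).
pose H (s : seq (A * M)) := e *: \sum_(p <- s) p.1 *: n p.2.
have HD s t : H (s ++ t) = H s + H t by rewrite /H big_cat scalerDr.
have HZ a s : H (lscale a s) = a *: H s.
  rewrite /H big_map scalerA mulrC -scalerA; congr (_ *: _).
  by rewrite scaler_sumr; apply: eq_bigr => p _; rewrite scalerA.
have hlin : linear (fun x => H (S x)).
  move=> a x y; apply/eqP; rewrite -subr_eq0; apply/eqP.
  have -> : H (S (a *: x + y)) - (a *: H (S x) + H (S y)) =
     H (S (a *: x + y) ++ (lscale (- a) (S x) ++ lscale (- 1) (S y))).
    by rewrite !HD !HZ !scaleNr scale1r opprD.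
  apply: (qfree_relation n Mflat Bfree).
    move=> p; rewrite !mem_cat => /orP[|/orP[/mapP[q qS ->]|/mapP[q qS ->]]].
    - by case: (hS (a *: x + y)) => h _ /h.
    - by case: (hS x) => h _; exact: (h q qS).
    - by case: (hS y) => h _; exact: (h q qS).
  rewrite !lcomb_cat !lcomb_scale.
  have E z : lcomb (S z) = e *: z by case: (hS z).
  rewrite !E scalerDr !scaleNr scale1r -opprD scalerA mulrC -scalerA.
  by rewrite subrr.
exists (lin_fun hlin) => m; rewrite /lin_fun /H linearZ linear_sum /=.
have [_ em] := hS m.
rewrite -[in RHS]eid -scalerA; congr (_ *: _).
have <- : f (e *: m) = e *: f m by rewrite linearZ.
rewrite em /lcomb linear_sum; apply: eq_bigr => p _.
by rewrite !linearZ -hn.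
Qed.

End LocalFactor.

(** Liftings multiplied by an idempotent [e] are constructed by noetherian
    induction on the annihilator of [e]. If some [a] is neither nilpotent nor
    invertible in [e A], the relation [x ^+ k = x ^+ k.+1 * c] for [x = a * e]
    yields an idempotent [y] strictly between 0 and [e], and the liftings for [y]
    and [e - y] add up. Otherwise [e A] is local with nil maximal ideal. *)
Lemma pi_regular_perfect (A : comPzRingType) : noetherian A ->
  (forall a : A, exists k c, a ^+ k = a ^+ k.+1 * c) -> perfect A.
Proof.
move=> noA hpi M Mflat N N' g f gsurj.
pose lifts e := exists h : {linear M -> N}, forall m, g (h m) = e *: f m.
suff lid (e : A) : e * e = e -> lifts e.
  have [h hh] := lid 1 (mulr1 1); exists h => m; by rewrite hh scale1r.
move: {2}(colon (gen [::]) e) (erefl (colon (gen [::]) e)) => I.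
elim/(noetherian_ind noA): I e => I IH e eI eid.
have annE x b : (x \in colon (gen [::]) b) = (x * b == 0).
  by rewrite colonE gen0.
have [e0|e0] := eqVneq e 0.
  by exists \0%R => m; rewrite e0 scale0r linear0.
have split_id x : x * x = x -> x * e = x -> x != 0 -> x != e -> lifts e.
  move=> xx xe x0 xne.
  have smaller y : y * e = y -> y != e -> y * y = y -> lifts y.
    move=> ye yne yy; apply: (IH _ _ _ y erefl yy).
      move=> z; rewrite -eI !annE => /eqP ze.
      by rewrite -ye (mulrC y) mulrA ze mul0r.
    move=> /(_ (e - y)); rewrite -eI !annE !mulrBl eid (mulrC e) ye yy subrr eqxx.
    by move=> /(_ isT) /eqP /subr0_eq yeq; rewrite yeq eqxx in yne.
  have [h1 hh1] := smaller x xe xne xx.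
  have [|||h2 hh2] := smaller (e - x).
  - by rewrite mulrBl eid xe.
  - by rewrite -subr_eq0 addrAC subrr add0r oppr_eq0.
  - by rewrite mulrBl !mulrBr eid (mulrC e) xe xx subrr subr0.
  exists (h1 \+ h2)%R => m /=; rewrite linearD hh1 hh2 -scalerDl.
  by rewrite addrC subrK.
have [[a [anil aunit]]|hloc] := pselect (exists a : A,
    (forall k, a ^+ k * e <> 0) /\ forall v, v * a * e <> e).
  pose x := a * e; have [k [c hk]] := hpi x.
  have xe : x * e = x by rewrite /x -mulrA eid.
  have hkn n : (k <= n)%N -> x ^+ n = x ^+ n.+1 * c.
    move=> kn; rewrite -(subnK kn) -addnS !exprD hk.
    by rewrite mulrA.
  have hx m n : (k <= n)%N -> x ^+ n = x ^+ (n + m) * c ^+ m.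
    move=> kn; elim: m => [|m IHm]; first by rewrite addn0 mulr1.
    rewrite IHm (hkn (n + m)%N) ?(leq_trans kn) ?leq_addr // addnS.
    by rewrite [c ^+ m.+1]exprS mulrA.
  pose y := x ^+ k.+1 * c ^+ k.+1.
  have xy : x ^+ k.+1 * y = x ^+ k.+1.
    by rewrite mulrA -exprD -(hx k.+1 k.+1 (leqnSn k)).
  apply: (split_id y).
  - by rewrite {1}/y mulrAC xy.
  - transitivity (x * e * (x ^+ k * c ^+ k.+1)); first by rewrite /y exprS; ring.
    by rewrite xe mulrA -exprS.
  - apply/eqP => y0; apply: (anil k.+1).
    move: xy; rewrite y0 mulr0 => /esym; rewrite /x exprMn.
    have -> // : e ^+ k.+1 = e.
    by elim: (k) => [|l IHl]; rewrite ?expr1 // exprS IHl.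
  - apply/eqP => ye; apply: (aunit (x ^+ k * c ^+ k.+1)).
    by rewrite -mulrA -/x mulrAC -exprSr.
(* A prime not containing [e] consists of the [a] that are nilpotent in [e A]. *)
have [||x|Q [hQ _ QS]] :=
    @prime_avoiding A noA (gen [::]) (fun x => x = 1 \/ x = e).
- by left.
- move=> x y [->|->] [->|->]; rewrite ?mulr1 ?mul1r ?eid; [by left|..];
  by right.
- move=> [->|->]; rewrite gen0 //; apply: contra e0 => /eqP e1.
  by rewrite -[e]mulr1 e1 mulr0.
have eQ : e \notin Q by apply: QS; right.
have dich a : (exists k, a ^+ k * e = 0) \/ exists v, v * a * e = e.
  apply: contrapT => /not_orP[h1 h2]; apply: hloc; exists a.
  by split=> [k hk|v hv]; [apply: h1; exists k | apply: h2; exists v].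
apply: (@lift_local _ noA e Q) => // a aQ.
  case: (dich a) => // -[k hk].
  have : a ^+ k * e \in Q by rewrite hk ideal0.
  by rewrite primeM // (negPf eQ) orbF => /(primeX hQ); rewrite (negPf aQ).
case: (dich a) => // -[v hv]; case/negP: eQ; rewrite -hv mulrAC.
exact: idealM.
Qed.

(** * Rings of fractions *)

Section FractionMap.
Variables (A B : comPzRingType) (phi : {rmorphism A -> B}).
Variables (I : ideal A) (S : A -> Prop).

(** [phi] exhibits [B] as the ring of fractions of [A / I] with denominators in
    [S]. It covers localizations of [A] and total quotient rings of quotients. *)
Record fraction_map : Prop := FractionMap {
  fm_eq0 : forall x, phi x = 0 <-> exists2 u, S u & u * x \in I;
  fm_unit : forall s, S s -> exists v, v * phi s = 1;
  fm_num : forall b, exists a s, S s /\ phi s * b = phi a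
}.

Lemma preimage_subproof (K : ideal B) : let J := [pred x | phi x \in K] in
  0 \in J /\ forall a, {in J &, forall x y, a * x + y \in J}.
Proof.
split=> [|a x y]; rewrite !inE ?rmorph0 ?ideal0 // => xK yK.
by rewrite rmorphD rmorphM idealMD.
Qed.

Definition preimage (K : ideal B) : ideal A := Ideal (preimage_subproof K).

Lemma preimageE K x : (x \in preimage K) = (phi x \in K).
Proof. by rewrite inE. Qed.

Hypothesis fm : fraction_map.

Lemma fm_unit_mem (K : ideal B) s b : S s -> (phi s * b \in K) = (b \in K).
Proof.
case/(fm_unit fm) => v hv; apply/idP/idP; last exact: idealM.
by move=> /(idealM v); rewrite mulrA hv mul1r.
Qed.

Lemma preimage_subset (K L : ideal B) :
  {subset preimage K <= preimage L} -> {subset K <= L}.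
Proof.
move=> KL b; have [a [s [Ss e]]] := fm_num fm b.
rewrite -(fm_unit_mem K b Ss) -(fm_unit_mem L b Ss) e -!preimageE.
exact: KL.
Qed.

Lemma noetherian_fractions : noetherian A -> noetherian B.
Proof.
move=> noA K; have [xs hxs] := noA (preimage K).
exists (map phi xs); have h : K = gen (map phi xs); last by move=> x; rewrite -h.
apply: ideal_sub_anti; last first.
  apply: gen_min => _ /mapP[x xxs ->]; rewrite -preimageE hxs.
  exact: mem_gen.
apply: preimage_subset => x; rewrite hxs; apply: gen_min => y yxs.
by rewrite preimageE; apply/mem_gen/map_f.
Qed.

Lemma preimage_prime (P : ideal B) : prime_ideal P -> prime_ideal (preimage P).
Proof.
move=> [P1 PM]; split; first by rewrite preimageE rmorph1.
by move=> u v; rewrite !preimageE rmorphM; apply: PM.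
Qed.

Lemma preimage_chain n (P Q : ideal B) :
  chain n P Q -> chain n (preimage P) (preimage Q).
Proof.
elim: n P => [|n IHn] P [hP].
  by move=> <-; split=> //; apply: preimage_prime.
move=> [P' [PP' P'P cP']]; split; first exact: preimage_prime.
exists (preimage P'); split; last exact: IHn.
  by move=> x; rewrite !preimageE; apply: PP'.
by move/preimage_subset.
Qed.

End FractionMap.

Section Localization.
Variables (A : comPzRingType) (S : mulrClosed A).

Definition locm (x : A) : loc_ring S := loc_frac (x, den1 S).

Lemma locm_zmod_morphism : zmod_morphism locm.
Proof.
move=> x y; rewrite /locm.
transitivity (loc_add (loc_frac (x, den1 S)) (loc_opp (loc_frac (y, den1 S)))).
  by rewrite loc_oppE loc_addE; apply: loc_frac_eq => /=; ring.
by [].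
Qed.

Lemma locm_monoid_morphism : monoid_morphism locm.
Proof.
split=> // x y.
transitivity (loc_mul (loc_frac (x, den1 S)) (loc_frac (y, den1 S))).
  by rewrite loc_mulE; apply: loc_frac_eq => /=; ring.
by [].
Qed.

HB.instance Definition _ := GRing.isZmodMorphism.Build A (loc_ring S) locm
  locm_zmod_morphism.
HB.instance Definition _ := GRing.isMonoidMorphism.Build A (loc_ring S) locm
  locm_monoid_morphism.

Lemma locm_fraction : fraction_map locm (gen [::]) (fun s => s \in S).
Proof.
split=> [x|s sS|b].
- rewrite -[0]/(loc_zero S) /locm /loc_zero loc_fracP /=.
  split=> -[u uS h]; exists u => //.
    by rewrite gen0; apply/eqP; move: h; rewrite mulr1 mul0r subr0.
  by move: h; rewrite gen0 => /eqP h; rewrite mulr1 mul0r subr0.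
- exists (loc_frac (1, exist _ s sS)).
  transitivity
    (loc_mul (loc_frac (1, exist _ s sS)) (loc_frac (s, den1 S))) => //.
  rewrite loc_mulE; transitivity (loc_one S) => //.
  by apply: loc_frac_eq => /=; ring.
- rewrite -[b]loc_reprK; case: (repr b) => a [s sS]; exists a, s; split=> //.
  transitivity
    (loc_mul (loc_frac (s, den1 S)) (loc_frac (a, exist _ s sS))) => //.
  by rewrite loc_mulE; apply: loc_frac_eq => /=; ring.
Qed.

(** The fractions [a / s] with [a] in [gen xs] form an ideal that contains the
    images of [xs], so they are all the elements of the extended ideal. *)
Lemma locm_gen xs x : reflect (exists2 u, u \in S & u * x \in gen xs)
  (locm x \in gen (map locm xs)).
Proof.
have fm := locm_fraction; apply: (iffP idP) => [h|[u uS h]]; last first.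
  rewrite -(fm_unit_mem fm _ _ uS) -rmorphM -preimageE.
  apply: (gen_min _ h) => y yxs; rewrite preimageE.
  exact/mem_gen/map_f.
pose E := [pred b : loc_ring S | `[< exists a s,
  [/\ a \in gen xs, s \in S & locm s * b = locm a] >]].
have hE : 0 \in E /\ forall a, {in E &, forall x y, a * x + y \in E}.
  split=> [|a b c]; rewrite !inE.
    apply/asboolP; exists 0, 1; split; rewrite ?ideal0 ?rpred1 //.
    by rewrite rmorph0 mulr0.
  move=> /asboolP[b' [s [bI sS eb]]] /asboolP[c' [t [cI tS ec]]]; apply/asboolP.
  have [a' [r [rS ea]]] := fm_num fm a.
  exists (t * a' * b' + r * s * c'), (r * s * t); split; last first.
  - rewrite rmorphD !rmorphM /= -eb -ec -ea; ring.
  - by rewrite !rpredM.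
  - by apply: rpredD; apply: idealM.
have : locm x \in Ideal hE.
  apply: (gen_min _ h) => _ /mapP[y yxs ->]; rewrite inE; apply/asboolP.
  by exists y, 1; rewrite mem_gen // rpred1 rmorph1 mul1r.
rewrite inE => /asboolP[a [s [aI sS e]]].
have /(fm_eq0 fm)[u uS] : locm (s * x - a) = 0 by rewrite rmorphB rmorphM e subrr.
rewrite gen0 mulrBr subr_eq0 => /eqP h'; exists (u * s); first exact: rpredM.
by rewrite -mulrA h' idealM.
Qed.

Lemma locm_nzd_mod ws x :
  nzd_mod (gen ws) x -> nzd_mod (gen (map locm ws)) (locm x).
Proof.
have fm := locm_fraction; move=> xI b.
have [a [s [sS e]]] := fm_num fm b.
rewrite -(fm_unit_mem fm _ _ sS) mulrCA e -rmorphM => /locm_gen[u uS].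
rewrite mulrCA => /xI ua.
by rewrite -(fm_unit_mem fm _ _ sS) e; apply/locm_gen; exists u.
Qed.

Lemma locm_regular_mod ws xs :
  regular_mod (gen ws) xs -> regular_mod (gen (map locm ws)) (map locm xs).
Proof.
elim: xs ws => [|x xs IHxs] ws //= [xI]; rewrite -!gen_rcons -map_rcons => h.
by split; [apply: locm_nzd_mod | apply: IHxs].
Qed.

End Localization.

(** * Subperfect quotients *)

Section Subperfect.
Variables (A : comPzRingType) (I : ideal A).

(** The canonical map from [A] to the total quotient ring of [A / I] *)
Definition frac_proj (x : A) : total_quotient (quotient_ring I) :=
  @locm (quotient_ring I) (@nzd_pred (quotient_ring I)) (quot_proj I x).

Lemma quot_projB x y : quot_proj I (x - y) = quot_proj I x - quot_proj I y.
Proof. by rewrite /quot_proj !piE. Qed.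

Lemma quot_proj_eq0 x : (quot_proj I x == 0) = (x \in I).
Proof. by rewrite -[x in RHS]subr0 -quot_projE /quot_proj !piE. Qed.

Lemma quot_proj_mul x y : quot_proj I (x * y) = quot_proj I x * quot_proj I y.
Proof. exact: quot_projM. Qed.

Lemma frac_proj_zmod_morphism : zmod_morphism frac_proj.
Proof. by move=> x y; rewrite /frac_proj quot_projB rmorphB. Qed.

Lemma frac_proj_monoid_morphism : monoid_morphism frac_proj.
Proof.
split; first exact: rmorph1.
by move=> x y; rewrite /frac_proj quot_proj_mul rmorphM.
Qed.

HB.instance Definition _ := GRing.isZmodMorphism.Build A
  (total_quotient (quotient_ring I)) frac_proj frac_proj_zmod_morphism.
HB.instance Definition _ := GRing.isMonoidMorphism.Build A
  (total_quotient (quotient_ring I)) frac_proj frac_proj_monoid_morphism.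

Lemma nzd_quotP x : non_zero_divisor (quot_proj I x) <-> nzd_mod I x.
Proof.
split=> h y.
  rewrite -!quot_proj_eq0 quot_proj_mul => /eqP /h ->; exact: eqxx.
rewrite -[y]quot_reprK -quot_proj_mul => /eqP.
by rewrite quot_proj_eq0 => /h; rewrite -quot_proj_eq0 => /eqP.
Qed.

Lemma frac_proj_fraction : fraction_map frac_proj I (nzd_mod I).
Proof.
have fm := locm_fraction (@nzd_pred (quotient_ring I)).
have nzdP x : (quot_proj I x \in @nzd_pred (quotient_ring I)) <-> nzd_mod I x.
  by rewrite inE; split=> [/asboolP|] /nzd_quotP // h; apply/asboolP.
split=> [x|s sI|b].
- split=> [/(fm_eq0 fm)[u]|[u uI /uI xI]].
    rewrite -[u]quot_reprK => /nzdP uI.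
    rewrite gen0 -quot_proj_mul quot_proj_eq0 => h.
    by exists (repr u).
  apply/(fm_eq0 fm); exists 1; first exact: rpred1.
  by rewrite mul1r gen0 quot_proj_eq0.
- by apply: (fm_unit fm); apply/nzdP.
- have [a [s [sS e]]] := fm_num fm b.
  exists (repr a), (repr s); split; first by apply/nzdP; rewrite quot_reprK.
  by rewrite /= /frac_proj !quot_reprK.
Qed.

(** For noetherian rings perfection of the total quotient ring is the absence of
    primes other than the maximal ones in it, which clearing denominators
    expresses in [A]. *)
Lemma subperfectP :
  noetherian A -> subperfect (quotient_ring I) <-> frac_zero_dim I.
Proof.
move=> noA; have fm := frac_proj_fraction.
have in_ker x : frac_proj x = 0 -> x \in I by case/(fm_eq0 fm) => u uI /uI.
split=> [hperf a|hpi].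
  have [k [c e]] := perfect_pi_regular (frac_proj a) hperf.
  have [b [t [tI ec]]] := fm_num fm c.
  exists k, t, b; split=> //; apply: in_ker.
  rewrite rmorphM rmorphXn rmorphB rmorphM /= -ec.
  transitivity ((frac_proj a ^+ k - frac_proj a ^+ k.+1 * c) * frac_proj t).
    by rewrite exprS; ring.
  by rewrite -e subrr mul0r.
apply: pi_regular_perfect; first exact: noetherian_fractions fm noA.
move=> b; have [a [t [tI eb]]] := fm_num fm b.
have [k [s [c [sI h]]]] := hpi a.
have [v hv] := fm_unit fm tI; have [w hw] := fm_unit fm sI.
exists k, (frac_proj t * frac_proj c * w).
have ebv : b = v * frac_proj a by rewrite -eb mulrA hv mul1r.
have : frac_proj (a ^+ k * (s - a * c)) = 0.
  apply/(fm_eq0 fm); exists 1; last by rewrite mul1r.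
  by move=> y; rewrite mul1r.
rewrite rmorphM rmorphXn rmorphB rmorphM mulrBr => /subr0_eq e.
rewrite ebv !exprMn.
transitivity (v ^+ k * (frac_proj a ^+ k * frac_proj s) * w).
  by rewrite -[LHS]mulr1 -hw; ring.
rewrite e !exprS -[in LHS](mulr1 (v ^+ k)) -hv; ring.
Qed.

End Subperfect.

(** * Regular sequences of a ring *)

Section RegularSeq.
Variable A : comPzRingType.
Implicit Types (I J P Q M : ideal A) (xs ys : seq A).

Lemma gen_properP xs : ~ (gen xs =i predT) <-> 1 \notin gen xs.
Proof.
split=> [h|/negP h e]; last by apply: h; rewrite e.
apply/negP => g1; apply: h => x; rewrite -[x]mulr1 idealM //.
Qed.

Lemma regular_mod_nth ws xs : regular_mod (gen ws) xs <->
  forall j, (j < size xs)%N -> nzd_mod (gen (ws ++ take j xs)) xs`_j.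
Proof.
elim: xs ws => [|x xs IHxs] ws //=; rewrite -gen_rcons IHxs.
split=> [[xI h] [|j]|h]; rewrite ?cats0 //= ?ltnS.
  by move=> /h; rewrite cat_rcons.
split; first by have := h 0%N isT; rewrite cats0.
by move=> j jlt; rewrite cat_rcons; apply: (h j.+1).
Qed.

Lemma regular_seqP xs :
  regular_seq xs <-> (xs <> [::] -> 1 \notin gen xs) /\ regular_mod (gen [::]) xs.
Proof.
rewrite regular_mod_nth; split=> -[h k]; split.
- by move=> /h /gen_properP.
- by move=> j /k /nzd_quotP.
- by move=> /h h1; apply/gen_properP.
- by move=> j /k h1; apply/nzd_quotP.
Qed.

Lemma regular_seq_sub M xs : 1 \notin M -> {subset xs <= M} ->
  regular_seq xs <-> regular_mod (gen [::]) xs.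
Proof.
move=> M1 xsM; rewrite regular_seqP; split=> [[]|h] //; split=> // _.
by apply: contra M1; apply: gen_min.
Qed.

Lemma regularly_subperfectP (noA : noetherian A) :
  regularly_subperfect A <-> forall xs, regular_seq xs -> frac_zero_dim (gen xs).
Proof.
by split=> h xs xsr; [apply/(subperfectP _ noA)/h | apply/(subperfectP _ noA)/h].
Qed.

Lemma sub_gen0 I : {subset gen [::] <= I}.
Proof. by move=> x; rewrite gen0 => /eqP->; apply: ideal0. Qed.

Lemma adjoins_gen0 xs : adjoins (gen [::]) xs = gen xs.
Proof. exact: adjoins_gen. Qed.

(** * Local rings *)

Definition unique_max M := maximal_ideal M /\
  forall M', maximal_ideal M' -> M' =i M.

Lemma unique_max_sub (noA : noetherian A) M I :
  unique_max M -> 1 \notin I -> {subset I <= M}.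
Proof.
move=> [_ Muniq] I1; have [M' hM' IM'] := exists_maximal noA I1.
by move=> x /IM'; rewrite (Muniq M' hM').
Qed.

Lemma unique_max_units (noA : noetherian A) M : unique_max M -> radical_units M.
Proof.
move=> Mu y yM c; have [[M1 _] _] := Mu.
have : 1 \in adjoin (gen [::]) (1 - y * c).
  apply: contraT => /(unique_max_sub noA Mu) /(_ _ (mem_adjoin _ _)) h.
  case/negP: M1; rewrite -(subrK (y * c) 1) rpredD // mulrC; exact: idealM.
by case/adjoinP=> v; rewrite gen0 subr_eq0 => /eqP e; exists v.
Qed.

Lemma regular_seq_max (noA : noetherian A) M xs :
  unique_max M -> regular_seq xs -> {subset xs <= M}.
Proof.
case: xs => [|x xs] // Mu /regular_seqP[h _].
have {}h : 1 \notin gen (x :: xs) by apply: h.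
by move=> y /mem_gen; apply: unique_max_sub.
Qed.

(** Since a regular sequence is never longer than the dimension, one that is at
    least as long as all chains of primes gives both depth and dimension. *)
Definition cm_data M ys :=
  [/\ unique_max M, regular_mod (gen [::]) ys, {subset ys <= M} &
      forall n P Q, chain n P Q -> (n <= size ys)%N].

Lemma max_ideal_not1 M : unique_max M -> 1 \notin M.
Proof. by case=> -[]. Qed.

Lemma regular_mod_le (noA : noetherian A) M ys xs : cm_data M ys ->
  regular_mod (gen [::]) xs -> {subset xs <= M} -> (size xs <= size ys)%N.
Proof.
move=> [[/maximal_prime hM _] _ _ dimA] xsr xsM.
by have [Q _ /dimA] := chain_below noA hM xsr xsM (@sub_gen0 M).
Qed.

Lemma cm_dataP (noA : noetherian A) :
  cohen_macaulay_local A <-> exists M ys, cm_data M ys.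
Proof.
split=> [[_ [M [hM Mu [d [[[ys [ysr ysM yss]] _] [_ dimA]]]]]]|[M [ys h]]].
  have hM1 : 1 \notin M by case: hM.
  exists M, ys; split=> //; first exact/(regular_seq_sub hM1 ysM).
  by rewrite yss => n P Q /prime_chainP[p [hp _ _]]; apply: dimA; exists p.
have [Mu ysr ysM dimA] := h; have M1 := max_ideal_not1 Mu.
split=> //; exists M; split; [by case: Mu | by case: Mu |].
exists (size ys); split; split.
- by exists ys; split=> //; apply/(regular_seq_sub M1 ysM).
- move=> k [xs [xsr xsM <-]]; apply: (regular_mod_le noA h) => //.
  exact/(regular_seq_sub M1 xsM).
- have [/maximal_prime hM _] := Mu.
  have [Q _ /prime_chainP[p [hp _ _]]] :=
    chain_below noA hM ysr ysM (@sub_gen0 M).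
  by exists p.
- by move=> k [p hp]; apply: (dimA k (p 0%N) (p k)); apply/prime_chainP; exists p.
Qed.

Lemma cm_local_frac_zero_dim (noA : noetherian A) M ys xs : cm_data M ys ->
  regular_seq xs -> frac_zero_dim (gen xs).
Proof.
move=> [Mu ysr ysM dimA] xsr; have xsM := regular_seq_max noA Mu xsr.
rewrite -adjoins_gen0.
apply: (cm_frac_zero_dim noA (unique_max_units noA Mu) dimA ysr) => //.
by case/regular_seqP: xsr.
Qed.

Lemma cm_n_subperfect (noA : noetherian A) M ys : cm_data M ys ->
  n_subperfect A (size ys).
Proof.
move=> h; have [Mu ysr ysM dimA] := h; have M1 := max_ideal_not1 Mu.
split.
  by apply/(regularly_subperfectP noA) => xs; apply: cm_local_frac_zero_dim h.
move=> xs [xsr xsmax]; have xsM := regular_seq_max noA Mu xsr.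
have xsr' : regular_mod (gen [::]) xs by case/regular_seqP: xsr.
apply/eqP; rewrite eqn_leq (regular_mod_le noA h) //=.
apply: (size_maximal_in noA _ ysr ysM); split=> // z zM zI; apply: (xsmax z).
apply/(regular_seq_sub M1).
  by move=> x; rewrite mem_rcons inE => /orP[/eqP->|/xsM].
by rewrite -cats1; apply/regular_mod_cat.
Qed.

End RegularSeq.

(** * Localization at a maximal ideal *)

Section LocalizationAt.
Variables (A : comPzRingType) (noA : noetherian A) (M : maxIdeal A).

Notation S := (@prime_compl A M).
Notation AM := (loc_ring S).
Notation phi := (@locm A S).

Lemma prime_complE x : (x \in S) = (x \notin max_val M).
Proof. by rewrite inE. Qed.

Let fm := locm_fraction S.

Lemma noetherian_loc : noetherian AM.
Proof. exact: noetherian_fractions fm noA. Qed.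

(** The extension of [M] to the localization *)
Definition maxloc_pred : {pred AM} := [pred b | `[< exists a s,
  [/\ a \in max_val M, s \in S & phi s * b = phi a] >]].

Lemma maxloc_subproof : 0 \in maxloc_pred /\
  forall a, {in maxloc_pred &, forall x y, a * x + y \in maxloc_pred}.
Proof.
split=> [|a b c]; rewrite !inE.
  apply/asboolP; exists 0, 1; split; rewrite ?ideal0 ?rpred1 //.
  by rewrite rmorph0 mulr0.
move=> /asboolP[b' [s [bI sS eb]]] /asboolP[c' [t [cI tS ec]]]; apply/asboolP.
have [a' [r [rS ea]]] := fm_num fm a.
exists (t * a' * b' + r * s * c'), (r * s * t); split; last first.
- rewrite rmorphD !rmorphM /= -eb -ec -ea; ring.
- by rewrite !rpredM.
- by apply: rpredD; apply: idealM.
Qed.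

Definition maxloc : ideal AM := Ideal maxloc_subproof.

Lemma maxloc_unit b : b \notin maxloc -> exists v, v * b = 1.
Proof.
move=> bM; have [a [s [sS e]]] := fm_num fm b.
have aS : a \in S.
  rewrite prime_complE; apply: contra bM => aM.
  by rewrite inE; apply/asboolP; exists a, s.
have [v hv] := fm_unit fm aS; exists (v * phi s).
by rewrite -mulrA e.
Qed.

Lemma maxlocE x : (phi x \in maxloc) = (x \in max_val M).
Proof.
apply/idP/idP=> [|xM]; last first.
  by rewrite inE; apply/asboolP; exists x, 1; rewrite rpred1 rmorph1 mul1r.
rewrite inE => /asboolP[a [s [aM sS e]]].
have /(fm_eq0 fm)[u uS] : phi (s * x - a) = 0 by rewrite rmorphB rmorphM e subrr.
rewrite gen0 mulrBr subr_eq0 => /eqP h.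
have : u * (s * x) \in max_val M by rewrite h idealM.
move: uS sS; rewrite !prime_complE !(primeM _ _ (maximal_prime (maxP M))).
by move=> /negPf-> /negPf->.
Qed.

Lemma maxloc_not1 : 1 \notin maxloc.
Proof. by rewrite -[1](rmorph1 phi) maxlocE; case: (maxP M). Qed.

Lemma maxloc_unique : unique_max maxloc.
Proof.
have proper (J : ideal AM) : 1 \notin J -> {subset J <= maxloc}.
  move=> J1 b bJ; apply: contraT => /maxloc_unit[v hv].
  by case/negP: J1; rewrite -hv idealM.
split; first by split=> [|J _]; [exact: maxloc_not1 | exact: proper].
move=> M' [M'1 M'max] x; apply/idP/idP; first exact: proper.
exact: M'max (proper M' M'1) maxloc_not1 x.
Qed.

(** Chains contract to chains inside [M], which may be completed by [M] itself. *)
Lemma maxloc_chain n (P Q : ideal AM) : chain n P Q ->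
  exists m, (n <= m)%N /\ exists P', chain m P' (max_val M).
Proof.
move=> c; have c' := preimage_chain fm c.
have [_ [Q1 _]] := chain_prime c.
have QM : {subset preimage phi Q <= max_val M}.
  move=> x; rewrite preimageE => xQ; apply: contraT => xM.
  have /(fm_unit fm)[v hv] : x \in S by rewrite prime_complE.
  by case/negP: Q1; rewrite -hv idealM.
have [MQ|MQ] := pselect {subset max_val M <= preimage phi Q}.
  exists n; split=> //; exists (preimage phi P).
  by rewrite -(ideal_sub_anti QM MQ).
exists (n + 1)%N; split; first exact: leq_addr.
exists (preimage phi P); apply: (chain_cat c'); apply: chain_step => //.
  by case: (chain_prime c').
exact: maximal_prime (maxP M).
Qed.

Lemma maxloc_regular xs :
  regular_mod (gen [::]) xs -> {subset xs <= max_val M} ->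
  regular_mod (gen [::]) (map phi xs) /\ {subset map phi xs <= maxloc}.
Proof.
move=> xsr xsM; split; first exact: (@locm_regular_mod _ _ [::]).
by move=> _ /mapP[x /xsM xM ->]; rewrite maxlocE.
Qed.

End LocalizationAt.

(** * Cohen-Macaulay and subperfect conditions *)

Section Equivalence.
Variables (R : comPzRingType) (noR : noetherian R).

Local Notation frac M := (locm (prime_compl M)).

(** Unmixedness is checked at a maximal ideal [M] above the associated prime
    [P = (xs : b)]: locally [a ^+ k * (t - a * c)] is zero modulo [xs] with [t]
    regular, and a numerator [n] of [t - a * c] is outside [P], since otherwise
    [t] would annihilate [b], which is still nonzero in the localization. *)
Lemma cm_regularly_subperfect : cohen_macaulay R -> regularly_subperfect R.
Proof.
move=> [_ cmR]; apply/(regularly_subperfectP noR) => xs xsr.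
apply: unmixed_frac_zero_dim => // b bI hP a aP.
have [P1 _] := hP; have [M0 hM PM] := exists_maximal noR P1.
pose M := MaxIdeal hM.
have fm := locm_fraction (prime_compl M).
have noM := @noetherian_loc R noR M.
have /(cm_dataP noM)[m [ys cmM]] := cmR M.
have xsM : {subset xs <= max_val M}.
  by move=> x xxs; apply/PM/sub_colon/mem_gen.
have [xsr' xsm] : regular_mod (gen [::]) (map (frac M) xs) /\
    {subset map (frac M) xs <= maxloc M}.
  by apply: maxloc_regular => //; case/regular_seqP: xsr.
have /(_ (frac M a))[k [t [c [tI h]]]] := cm_local_frac_zero_dim noM cmM
  (iffRL (regular_seq_sub (maxloc_not1 M) xsm) xsr').
have [n [s [sS e]]] := fm_num fm (t - frac M a * c).
have notb : frac M b \notin gen (map (frac M) xs).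
  apply/negP => /locm_gen[u uS ub]; move: uS; rewrite prime_complE.
  by case/negP; apply/PM; rewrite colonE.
have mulb x : x \in colon (gen xs) b ->
    frac M x * frac M b \in gen (map (frac M) xs).
  rewrite colonE => xb; rewrite -rmorphM; apply/locm_gen; exists 1.
    exact: rpred1.
  by rewrite mul1r.
have nP : n \notin colon (gen xs) b.
  apply/negP => /mulb; rewrite -e -mulrA (fm_unit_mem fm _ _ sS) => tb.
  case/negP: notb; apply: tI.
  have -> : t * frac M b =
    (t - frac M a * c) * frac M b + c * (frac M a * frac M b) by ring.
  by rewrite rpredD // idealM // mulb.
have : frac M (a ^+ k * n) \in gen (map (frac M) xs).
  by rewrite rmorphM rmorphXn -e mulrCA idealM.
move=> /locm_gen[u uS]; rewrite mulrCA mulrC => uan.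
exists (u * n), k; split; last by [].
rewrite primeM // negb_or nP andbT; apply/negP => /PM uM.
by move: uS; rewrite prime_complE uM.
Qed.

(** A maximal regular sequence [xs] in [M] gives the height of [M], and its image
    makes the localization Cohen-Macaulay of dimension [size xs]. *)
Lemma regularly_subperfect_local : regularly_subperfect R ->
  forall M : maxIdeal R, exists2 n : nat, has_height (max_val M) n
                                        & n_subperfect (localization_at M) n.
Proof.
move=> /(regularly_subperfectP noR) hpi M.
have hM := maxP M; have pM := maximal_prime hM.
have M1 : 1 \notin max_val M by case: hM.
have [xs xsmax] := exists_maximal_in noR (@sub_gen0 _ (max_val M)) M1.
have [xsr xsM _] := xsmax.
have dimM m P : chain m P (max_val M) -> (m <= size xs)%N.
  move=> /(regular_of_chain (@sub_gen0 _ P))[|ys [ysr ysM <-]].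
    move=> ys ysr ysM; rewrite adjoins_gen0; apply: hpi.
    exact/(regular_seq_sub M1 ysM).
  exact: size_maximal_in xsmax ysr ysM.
exists (size xs).
  split=> [|k [p hp pk]].
    have [Q _ /prime_chainP[p [hp _ pM']]] :=
      chain_below noR pM xsr xsM (@sub_gen0 _ _).
    by exists p => // x; rewrite pM'.
  apply: (dimM k (p 0%N)); apply/prime_chainP; exists p.
  by split=> //; apply: ideal_ext.
have [xsr' xsM'] := maxloc_regular xsr xsM.
rewrite -(size_map (frac M) xs).
suff cmM : cm_data (maxloc M) (map (frac M) xs).
  exact: (cm_n_subperfect (@noetherian_loc R noR M) cmM).
split=> //; first exact: maxloc_unique.
move=> n P Q /maxloc_chain[m [nm [P' /dimM]]].
by rewrite size_map; apply: leq_trans.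
Qed.

Lemma local_cm : (forall M : maxIdeal R, exists2 n : nat,
    has_height (max_val M) n & n_subperfect (localization_at M) n) ->
  cohen_macaulay R.
Proof.
move=> h; split=> // M; have [n _ [hpi _]] := h M.
have noM := @noetherian_loc R noR M.
have {}hpi := iffLR (regularly_subperfectP noM) hpi.
have M1 := maxloc_not1 M; have Mu := maxloc_unique M.
have [xs xsmax] := exists_maximal_in noM (@sub_gen0 _ (maxloc M)) M1.
have [xsr xsM _] := xsmax.
apply/(cm_dataP noM); exists (maxloc M), xs; split=> //.
move=> k P Q cPQ; have [Pp [Q1 _]] := chain_prime cPQ.
have QM := unique_max_sub noM Mu Q1.
have [|ys [ysr ysQ <-]] := regular_of_chain (@sub_gen0 _ P) cPQ.
  move=> ys ysr ysQ; rewrite adjoins_gen0; apply: hpi.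
  by apply/(regular_seq_sub M1) => // x /ysQ /QM.
by apply: size_maximal_in xsmax ysr _ => // x /ysQ /QM.
Qed.

End Equivalence.

Theorem corollary4p4 (R : comPzRingType) (hR : noetherian R) :
  [<-> cohen_macaulay R;
       regularly_subperfect R;
       forall M : maxIdeal R,
         exists2 n : nat, has_height (max_val M) n
                        & n_subperfect (localization_at M) n].
Proof.
tfae.
- exact: cm_regularly_subperfect.
- exact: regularly_subperfect_local.
- exact: local_cm.
Qed.
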